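(* Let $s$ be a function of locally bounded variation on $\mathbb{R}$ with $s(x)=0$ for $x<0$. Suppose that for each $y>0$ the integral $\mathcal{L}\{\mathrm{d}s;y\}:=\int_0^\infty e^{-yx}\,\mathrm{d}s(x)$ exists in the $(\mathrm{C})$ sense. Assume furthermore that there exist $A,B>0$ such that $s(x)+A\log x$ is non-decreasing on $[B,\infty)$. Let $a,b$ be constants. Then $$\mathcal{L}\{\mathrm{d}s;y\}=a+b\log\left(\frac{1}{y}\right)+o(1),\qquad y\to0^+,$$ if and only if $$s(x)=s(0)+a+b\gamma+b\log x+o(1),\qquad x\to\infty,$$ where $\gamma$ is Euler's constant.
   Context: Stieltjes integrals $\int_0^x\varphi(t)\,\mathrm{d}s(t)$ are taken over $[0,x]$ with $s(0)$ as the initial value, so that $\int_0^x\mathrm{d}s(t)=s(x)-s(0)$. For a function $G$ vanishing on $(-\infty,0)$ and an integer $k\geq1$, let $G^{(-k)}(x)=\frac{1}{(k-1)!}\int_0^x(x-t)^{k-1}G(t)\,dt$ ($G^{(0)}=G$); $G$ has limit $\ell$ in the sense $(\mathrm{C},k)$ if $G^{(-k)}(x)=\ell x^k/k!+o(x^k)$ as $x\to\infty$, and ''$(\mathrm{C})$'' means $(\mathrm{C},k)$ for some $k$ (which may depend on $y$). The integral $\int_0^\infty e^{-yx}\mathrm{d}s(x)$ exists in the $(\mathrm{C})$ sense, with value $\mathcal{L}\{\mathrm{d}s;y\}$, if the function $x\mapsto\int_0^x e^{-yt}\,\mathrm{d}s(t)$ ($x\geq0$, extended by $0$ for $x<0$)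 has a $(\mathrm{C})$ limit as $x\to\infty$. *)

(* Defs.v *)
From HB Require Import structures.
From mathcomp Require Import all_boot all_order all_algebra.
From mathcomp Require Import all_classical all_reals all_analysis.
Set Implicit Arguments. Unset Strict Implicit. Unset Printing Implicit Defensive.
Import Order.TTheory GRing.Theory Num.Theory.
Import numFieldNormedType.Exports.
Local Open Scope classical_set_scope.
Local Open Scope ring_scope.

Section Defs.
Context {R : realType}.

Definition locally_bv (s : R -> R) :=
  forall a b : R, a <= b -> bounded_variation a b s.

(* Riemann--Stieltjes sum for the partition a = x_0 < x_1 < ... < x_n = b
   (x_{i+1} = nth b s i) with tags t_i in [x_i, x_{i+1}]. *)
Definition RS_sum (f g : R -> R) (a b : R) (s t : seq R) :=
  \sum_(0 <= n < size s)
     f (nth 0 t n) * (g (nth b (a :: s) n.+1) - g (nth b (a :: s) n)).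

Definition is_RS_integral (f g : R -> R) (a b I : R) :=
  forall e : R, 0 < e -> exists2 d : R, 0 < d &
    forall s t : seq R, itv_partition a b s -> size t = size s ->
      (forall n, (n < size s)%N ->
         [/\ nth b (a :: s) n <= nth 0 t n,
             nth 0 t n <= nth b (a :: s) n.+1 &
             nth b (a :: s) n.+1 - nth b (a :: s) n < d]) ->
      `| RS_sum f g a b s t - I | < e.

Definition RS_integral (f g : R -> R) (a b : R) : R :=
  xget 0 [set I | is_RS_integral f g a b I].

(* x |-> \int_0^x e^{-yt} ds(t) for x >= 0, extended by 0 for x < 0.
   (Integral over [0,x] with initial value s(0): \int_0^x ds = s x - s 0.) *)
Definition laplace_partial (s : R -> R) (y : R) (x : R) : R :=
  if 0 <= x then RS_integral (fun t => expR (- (y * t))) s 0 x else 0.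

Definition cesaro_iter (G : R -> R) (k : nat) (x : R) : R :=
  if k is k'.+1 then
    (k'`!%:R)^-1 * \int[lebesgue_measure]_(t in `[0, x]) ((x - t) ^+ k' * G t)
  else G x.

Definition cesaro_lim (G : R -> R) (k : nat) (l : R) :=
  (fun x => (cesaro_iter G k x - l * x ^+ k / k`!%:R) / x ^+ k)
    x @[x --> +oo] --> 0.

Definition C_lim (G : R -> R) (l : R) := exists k : nat, cesaro_lim G k l.

Definition laplace_C_exists (s : R -> R) (y : R) :=
  exists l : R, C_lim (laplace_partial s y) l.

Definition laplace_C (s : R -> R) (y : R) : R :=
  xget 0 [set l | C_lim (laplace_partial s y) l].

Definition euler_gamma : R :=
  limn (fun n : nat => \sum_(0 <= k < n) (k.+1%:R)^-1 - ln (n%:R : R)).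

End Defs.

(* Main.v *)
(** For y > 0 write M_y f for the integral of y e^{-yt} f(t) over [0, oo[, a
    mean of f for a probability measure.

    Integration by parts turns the partial Laplace integrals of ds into
    e^{-yx} s(x) - s(0) plus a truncated mean of s.  Since s(x) + C x is
    nondecreasing for large x, these partial integrals are nondecreasing up to
    a bounded term, so a (C) limit bounds them; this forces s(x) = O(e^{ex})
    for every e > 0, and then L{ds; y} = M_y s - s(0) is an ordinary limit.

    Logarithms are compared with H(x), the sum of the 1/k for 1 <= k <= x:
    H(x) = log x + gamma + o(1), while M_y H = - log (1 - e^{-y}), which is
    log (1/y) + o(1).  The implication from s to its transform is then the
    fact that M_y f -> 0 whenever f -> 0.

    Conversely, for suitable A, h = s + A log is nondecreasing for large x, and
    t(x) = h(x) - (A + b) H(x) - c has M_y t -> 0.  Two combinations of M_y h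
    and M_{2y} h bound h(x) above and below, so t is bounded.  Hence the means
    of P(e^{-yx}) t(x) tend to 0 for every polynomial P.  For P a power that
    concentrates on a window [X, (1 + w) X], this bounds the minimum of t on
    the window above by o(1), and likewise for -t; as t cannot decrease by more
    than about (A + b) w on such a window, t -> 0. *)
Require Import Defs.
From HB Require Import structures.
From mathcomp Require Import all_boot all_order all_algebra.
From mathcomp Require Import all_classical all_reals all_analysis.
From mathcomp Require Import measurable_realfun ring lra.
Import Order.TTheory GRing.Theory Num.Theory.
Import numFieldNormedType.Exports.
Local Open Scope classical_set_scope.
Local Open Scope ring_scope.
Set Implicit Arguments.
Unset Strict Implicit.
Unset Printing Implicit Defensive.

(** * Exponential means of subexponential functions *)

Section ExponentialAverage.
Context {R : realType}.
Implicit Types (f g : R -> R) (y t x c : R).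
Notation mu := (@lebesgue_measure R).

Definition exp_mean f y : R :=
  \int[mu]_(t in `[0, +oo[) (y * expR (- (y * t)) * f t).

Definition step x t : R := ((x <= t)%R : bool)%:R.

(** Growth below every exponential makes [exp_mean f y] absolutely convergent for all y > 0 at once,
    and the class is stable under products, so it also holds t f(t). *)
Definition subexp f := measurable_fun (`[0, +oo[ : set R) f /\
  forall e, 0 < e -> exists K, forall t, 0 <= t -> `|f t| <= K * expR (e * t).

(** The regularity available before any growth of s is known; it suffices for integrals over bounded
    windows. *)
Definition locbd f := measurable_fun (`[0, +oo[ : set R) f /\
  forall x, exists K, forall t, 0 <= t <= x -> `|f t| <= K.

Lemma is_derive_expRM y x :
  is_derive x 1 (fun t => - expR (- (y * t))) (y * expR (- (y * x))).
Proof.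
have h : is_derive x 1 (fun t : R => - (y * t)) (- y).
  by apply: is_derive_eq; rewrite /GRing.scale /= mulr1.
apply: is_derive_eq; rewrite /GRing.scale /=; ring.
Qed.

Lemma continuous_expRM y : continuous (fun t : R => expR (- (y * t))).
Proof.
move=> x; apply: continuous_comp; last exact: continuous_expR.
apply: (@continuousN _ R^o); exact: mulrl_continuous.
Qed.

Lemma cvg_expRM y : 0 < y -> expR (- (y * t)) @[t --> +oo] --> (0 : R).
Proof.
move=> y0.
apply: (@cvg_comp _ _ _ (fun t => y * t) (fun z => expR (- z)) _ (pinfty_nbhs R)).
  exact: gt0_cvgMry.
exact: cvgr_expR.
Qed.

Lemma integral_exp_tail y x : 0 < y ->
  (\int[mu]_(t in `[x, +oo[) (y * expR (- (y * t)))%:E = (expR (- (y * x)))%:E)%E.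
Proof.
move=> y0.
rewrite (@ge0_continuous_FTC2y _ _ (fun t => - expR (- (y * t))) _ 0)//.
- by rewrite -EFinB opprK add0r.
- by move=> t _; rewrite mulr_ge0 ?expR_ge0 // ltW.
- apply: continuous_subspaceT => t.
  by apply: cvgM; [exact: cvg_cst|exact: continuous_expRM].
- rewrite -oppr0; apply: cvgN; exact: cvg_expRM.
- apply: cvgN; apply: cvg_at_right_filter; exact: continuous_expRM.
- move=> t _; rewrite derive1E; by have := is_derive_expRM y t; case.
Qed.

Lemma measurable_expRM y (D : set R) : measurable D ->
  measurable_fun D (fun t : R => expR (- (y * t))).
Proof.
move=> mD; apply: measurable_funTS; apply: continuous_measurable_fun.
exact: continuous_expRM.
Qed.

Lemma integrable_exp y : 0 < y ->
  mu.-integrable `[0, +oo[ (EFin \o (fun t => y * expR (- (y * t)))).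
Proof.
move=> y0; apply/integrableP; split.
  apply/measurable_EFinP; apply: measurable_funM => //.
  exact: measurable_expRM.
under eq_integral do rewrite /= ger0_norm ?mulr_ge0 ?expR_ge0 ?(ltW y0)//.
by rewrite integral_exp_tail // ltry.
Qed.

(** Half of the decay absorbs f: with |f(t)| <= K e^{yt/2}, the integrand is dominated by 2K times
    the density at y/2. *)
Lemma integrable_subexp f y : 0 < y -> subexp f ->
  mu.-integrable `[0, +oo[ (EFin \o (fun t => y * expR (- (y * t)) * f t)).
Proof.
move=> y0 [mf /(_ (y / 2))]; rewrite divr_gt0// => /(_ isT)[K fK].
have y2 : 0 < y / 2 by rewrite divr_gt0.
apply: (le_integrable _ _ _ (integrableZl _ (2 * K) (integrable_exp y2))) => //.
- apply/measurable_EFinP; apply: measurable_funM => //.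
  apply: measurable_funM => //; exact: measurable_expRM.
- move=> t /=; rewrite in_itv/= andbT => t0.
  rewrite lee_fin normrM ger0_norm ?mulr_ge0 ?expR_ge0 ?(ltW y0)//.
  apply: le_trans (ler_norm _).
  have -> : 2 * K * (y / 2 * expR (- (y / 2 * t))) =
    y * expR (- (y * t)) * (K * expR (y/2 * t)).
    have -> : - (y / 2 * t) = - (y * t) + y / 2 * t by lra.
    by rewrite expRD; field.
  by rewrite ler_wpM2l ?fK// mulr_ge0 ?expR_ge0 ?(ltW y0).
Qed.

Lemma exp_meanD f g y : 0 < y -> subexp f -> subexp g ->
  exp_mean (fun t => f t + g t) y = exp_mean f y + exp_mean g y.
Proof.
move=> y0 sf sg; rewrite /exp_mean -RintegralD//; try exact: integrable_subexp.
by apply: eq_Rintegral => t _; rewrite mulrDr.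
Qed.

Lemma exp_meanZ c f y : 0 < y -> subexp f ->
  exp_mean (fun t => c * f t) y = c * exp_mean f y.
Proof.
move=> y0 sf; rewrite /exp_mean -RintegralZl//; try exact: integrable_subexp.
by apply: eq_Rintegral => t _; rewrite mulrCA.
Qed.

Lemma eq_exp_mean f g y : (forall t, 0 <= t -> f t = g t) ->
  exp_mean f y = exp_mean g y.
Proof.
move=> fg; apply: eq_Rintegral => t.
by rewrite inE/= in_itv/= andbT => t0; rewrite fg.
Qed.

Lemma le_exp_mean f g y : 0 < y -> subexp f -> subexp g ->
  (forall t, 0 <= t -> f t <= g t) -> exp_mean f y <= exp_mean g y.
Proof.
move=> y0 sf sg fg; apply: le_Rintegral => //; try exact: integrable_subexp.
move=> t; rewrite /= in_itv/= andbT => t0.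
by rewrite ler_wpM2l ?fg// mulr_ge0 ?expR_ge0 ?(ltW y0).
Qed.

(** The source of all explicit means below: constants, windows and harmonic sums are built from
    steps. *)
Lemma exp_mean_step x y : 0 < y -> 0 <= x ->
  exp_mean (step x) y = expR (- (y * x)).
Proof.
move=> y0 x0; rewrite /exp_mean.
have <- : fine (\int[mu]_(t in `[x, +oo[) (y * expR (- (y * t)))%:E) = expR (- (y * x)).
  by rewrite integral_exp_tail.
have -> : `[x, +oo[%classic = `[0, +oo[%classic `&` `[x, +oo[%classic :> set R.
  apply/seteqP; split=> t /=; rewrite !in_itv/= !andbT; last by case.
  by move=> xt; split => //; exact: le_trans xt.
rewrite -[RHS]/(Rintegral _ _ _) Rintegral_mkcondr.
apply: eq_Rintegral => t _; rewrite /step /patch.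
case: ifPn; rewrite ?inE ?notin_setE/= in_itv/= andbT.
  by move=> ->; rewrite mulr1.
by move=> /negP/negPf ->; rewrite mulr0.
Qed.

Lemma exp_mean1 y : 0 < y -> exp_mean (fun=> 1) y = 1.
Proof.
move=> y0; have := exp_mean_step y0 (lexx 0); rewrite mulr0 oppr0 expR0 => H; rewrite -[RHS]H.
by apply: eq_exp_mean => t t0; rewrite /step t0.
Qed.

Lemma subexp_bounded f K : measurable_fun (`[0, +oo[ : set R) f ->
  (forall t, 0 <= t -> `|f t| <= K) -> subexp f.
Proof.
move=> mf fK; split => // e e0; exists K => t t0.
apply: (le_trans (fK _ t0)); rewrite ler_peMr//.
  exact: le_trans (fK _ t0).
by rewrite -expR0 ler_expR mulr_ge0// ltW.
Qed.

Lemma subexp_cst c : subexp (fun=> c).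
Proof. exact: (@subexp_bounded _ `|c|). Qed.

Lemma subexpD f g : subexp f -> subexp g -> subexp (fun t => f t + g t).
Proof.
move=> [mf fe] [mg ge]; split; first exact: measurable_funD.
move=> e e0; have [K fK] := fe e e0; have [L gL] := ge e e0.
exists (K + L) => t t0; apply: (le_trans (ler_normD _ _)).
by rewrite mulrDl lerD ?fK ?gL.
Qed.

Lemma subexpM_bounded f g K : measurable_fun (`[0, +oo[ : set R) g ->
  (forall t, 0 <= t -> `|g t| <= K) -> subexp f -> subexp (fun t => g t * f t).
Proof.
move=> mg gK [mf fe]; split; first exact: measurable_funM.
move=> e e0; have [L fL] := fe e e0; exists (K * L) => t t0.
by rewrite normrM -mulrA ler_pM ?fL ?gK.
Qed.

Lemma subexpZ c f : subexp f -> subexp (fun t => c * f t).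
Proof. exact: (@subexpM_bounded _ (fun=> c) `|c|). Qed.

Lemma subexp_abs f : subexp f -> subexp (fun t => `|f t|).
Proof.
move=> [mf fe]; split; first exact: measurableT_comp.
move=> e e0; have [L fL] := fe e e0; exists L => t t0; rewrite normr_id; exact: fL.
Qed.

Lemma exp_meanB f g y : 0 < y -> subexp f -> subexp g ->
  exp_mean (fun t => f t - g t) y = exp_mean f y - exp_mean g y.
Proof.
move=> y0 sf sg; rewrite -[in RHS]mulN1r -exp_meanZ// -exp_meanD//; last exact: subexpZ.
by apply: eq_exp_mean => t _; rewrite mulN1r.
Qed.

Lemma subexpB f g : subexp f -> subexp g -> subexp (fun t => f t - g t).
Proof.
move=> sf sg; have /(subexpD sf) := subexpZ (-1) sg.
by congr subexp; apply/funext => t; rewrite mulN1r.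
Qed.

Lemma exp_mean_cst c y : 0 < y -> exp_mean (fun=> c) y = c.
Proof.
move=> y0; rewrite -[RHS]mulr1 -(exp_mean1 y0) -exp_meanZ//; last exact: subexp_cst.
by apply: eq_exp_mean => t _; rewrite mulr1.
Qed.

Lemma norm_exp_mean f g y : 0 < y -> subexp f -> subexp g ->
  (forall t, 0 <= t -> `|f t| <= g t) -> `|exp_mean f y| <= exp_mean g y.
Proof.
move=> y0 sf sg fg; rewrite ler_norml -[X in X <= _ <= _]mulN1r -exp_meanZ//.
apply/andP; split; apply: le_exp_mean => //; try exact: subexpZ.
  by move=> t /fg; rewrite mulN1r ler_norml => /andP[].
by move=> t /fg; rewrite ler_norml => /andP[].
Qed.

Lemma measurable_step x (D : set R) : measurable D -> measurable_fun D (step x).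
Proof.
move=> mD; apply: nondecreasing_measurable => // t u tu.
rewrite /step ler_nat; case: (boolP (x <= t)) => // xt.
by rewrite (le_trans xt tu).
Qed.

End ExponentialAverage.

(** * Riemann-Stieltjes integrals of exponentials by parts *)

Section StieltjesByParts.
Context {R : realType}.
Implicit Types (f g V : R -> R) (y t x u v c : R).

(** What integration by parts gives for the integral of e^{-yt} df(t) over [0, x]; for t >= 0 the
    factor [1 - step x t] is the indicator of [0, x[. *)
Definition stieltjes_exp f y x : R :=
  expR (- (y * x)) * f x - f 0 + exp_mean (fun t => (1 - step x t) * f t) y.

Lemma nondecreasing_locbd f :
  (forall u v, 0 <= u -> u <= v -> f u <= f v) -> locbd f.
Proof.
move=> ndf; split.
  have : measurable_fun (`[0, +oo[ : set R) (fun t => f (Num.max 0 t)).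
    apply: nondecreasing_measurable => // u v uv; apply: ndf.
      by rewrite le_max lexx.
    by rewrite ge_max !le_max lexx uv orbT.
  apply: eq_measurable_fun => t; rewrite inE/= in_itv/= andbT => t0.
  by rewrite max_r.
move=> x; exists (`|f 0| + `|f x|) => t /andP[t0 tx].
have := ndf _ _ (lexx 0) t0; have := ndf _ _ t0 tx.
have := ler_norm (f x); have := ler_norm (- f 0); rewrite normrN => *.
have := normr_ge0 (f 0); have := normr_ge0 (f x) => *.
by rewrite ler_norml; apply/andP; split; lra.
Qed.

Lemma locbdD f g : locbd f -> locbd g -> locbd (fun t => f t + g t).
Proof.
move=> [mf bf] [mg bg]; split; first exact: measurable_funD.
move=> x; have [K fK] := bf x; have [L gL] := bg x.
by exists (K + L) => t tx; rewrite (le_trans (ler_normD _ _))// lerD ?fK ?gL.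
Qed.

Lemma locbdZ c f : locbd f -> locbd (fun t => c * f t).
Proof.
move=> [mf bf]; split; first exact: measurable_funM.
move=> x; have [K fK] := bf x.
by exists (`|c| * K) => t tx; rewrite normrM ler_wpM2l ?fK.
Qed.

Lemma locbdB f g : locbd f -> locbd g -> locbd (fun t => f t - g t).
Proof.
move=> bf /(locbdZ (-1)) /(locbdD bf).
by congr locbd; apply/funext => t; rewrite mulN1r.
Qed.

Lemma eq_locbd f g : (forall t, 0 <= t -> f t = g t) -> locbd f -> locbd g.
Proof.
move=> fg [mf bf]; split.
  by apply: eq_measurable_fun mf => t; rewrite inE/= in_itv/= andbT => /fg.
move=> x; have [K fK] := bf x; exists K => t /andP[t0 tx].
by rewrite -fg// fK// t0.
Qed.

Lemma window_range u v t : u <= v -> 0 <= step u t - step v t <= 1.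
Proof.
move=> uv; rewrite /step.
case: (boolP (v <= t)) => vt; first by rewrite (le_trans uv vt) subrr lexx ler01.
by case: (u <= t); rewrite subr0 ?lexx ?ler01.
Qed.

Lemma measurable_window u v (D : set R) : measurable D ->
  measurable_fun D (fun t => step u t - step v t).
Proof. by move=> mD; apply: measurable_funB; exact: measurable_step. Qed.

Lemma subexp_window f u v : u <= v -> locbd f ->
  subexp (fun t => (step u t - step v t) * f t).
Proof.
move=> uv [mf bf]; have [K fK] := bf v.
apply: (@subexp_bounded _ _ `|K|).
  by apply: measurable_funM => //; exact: measurable_window.
move=> t t0; have [tv|vt] := ltP t v.
  rewrite normrM -[leRHS]mul1r ler_pM//.
    by have /andP[h0 h1] := window_range t uv; rewrite ger0_norm.
  by apply: le_trans (ler_norm _); rewrite fK// t0 ltW.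
by rewrite /step vt (le_trans uv vt) subrr mul0r normr0.
Qed.

Lemma subexp_step x : subexp (step x).
Proof.
apply: (@subexp_bounded _ _ 1); first exact: measurable_step.
by move=> t _; rewrite /step; case: (x <= t); rewrite ?normr1 ?normr0.
Qed.

Lemma exp_mean_window c u v y : 0 < y -> 0 <= u -> u <= v ->
  exp_mean (fun t => (step u t - step v t) * c) y =
  c * (expR (- (y * u)) - expR (- (y * v))).
Proof.
move=> y0 u0 uv; rewrite -!exp_mean_step ?(le_trans u0)//.
rewrite -exp_meanB; [|by []|exact: subexp_step|exact: subexp_step].
rewrite -exp_meanZ; [|by []|by apply: subexpB; exact: subexp_step].
by apply: eq_exp_mean => t _; rewrite mulrC.
Qed.

Lemma locbd_cst c : locbd (fun=> c).
Proof. by apply: nondecreasing_locbd. Qed.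

Lemma exp_mean_window_ge c f u v y : 0 < y -> 0 <= u -> u <= v -> locbd f ->
  (forall t, u <= t < v -> c <= f t) ->
  c * (expR (- (y * u)) - expR (- (y * v))) <=
  exp_mean (fun t => (step u t - step v t) * f t) y.
Proof.
move=> y0 u0 uv bf cf; rewrite -exp_mean_window//.
apply: le_exp_mean => //; try exact: subexp_window.
  by apply: subexp_window => //; exact: locbd_cst.
move=> t t0; rewrite /step.
case: (boolP (v <= t)) => vt; first by rewrite (le_trans uv vt) subrr !mul0r.
case: (boolP (u <= t)) => ut; last by rewrite subrr !mul0r.
by rewrite subr0 !mul1r cf// ut ltNge vt.
Qed.

Lemma stieltjes_exp_incr f u v y : 0 < y -> 0 <= u -> u <= v -> locbd f ->
  stieltjes_exp f y v - stieltjes_exp f y u =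
  expR (- (y * v)) * f v - expR (- (y * u)) * f u +
  exp_mean (fun t => (step u t - step v t) * f t) y.
Proof.
move=> y0 u0 uv bf; rewrite /stieltjes_exp.
have e x : 0 <= x -> exp_mean (fun t => (1 - step x t) * f t) y =
    exp_mean (fun t => (step 0 t - step x t) * f t) y.
  by move=> x0; apply: eq_exp_mean => t t0; rewrite {2}/step t0.
rewrite !e ?(le_trans u0)//.
have -> : exp_mean (fun t => (step u t - step v t) * f t) y =
   exp_mean (fun t => (step 0 t - step v t) * f t) y -
   exp_mean (fun t => (step 0 t - step u t) * f t) y.
  rewrite -exp_meanB//; try by apply: subexp_window => //; exact: le_trans uv.
  by apply: eq_exp_mean => t _; ring.
ring.
Qed.

Lemma expR_window_le u v y : 0 < y -> 0 <= u -> u <= v ->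
  expR (- (y * u)) - expR (- (y * v)) <= y * (v - u).
Proof.
move=> y0 u0 uv.
have -> : - (y * v) = - (y * u) + - (y * (v - u)) by ring.
rewrite expRD.
have := expR_ge1Dx (- (y * (v - u))).
have : expR (- (y * u)) <= 1 by rewrite expR_le1 oppr_le0 mulr_ge0// ltW.
have := expR_ge0 (- (y * u)).
have : 0 <= y * (v - u) by rewrite mulr_ge0 ?(ltW y0)// subr_ge0.
set E := expR _; set F := expR _; set w := y * _ => w0 E0 E1 F1.
nra.
Qed.

(** Replacing f by its lower bound f(u) inside the window integral cancels the boundary term at u
    and leaves the left-hand side. *)
Lemma stieltjes_exp_ge f u v y : 0 < y -> 0 <= u -> u <= v -> locbd f ->
  (forall t, u <= t < v -> f u <= f t) ->
  expR (- (y * v)) * (f v - f u) <= stieltjes_exp f y v - stieltjes_exp f y u.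
Proof.
move=> y0 u0 uv bf fu; rewrite stieltjes_exp_incr//.
have := exp_mean_window_ge y0 u0 uv bf fu.
by rewrite mulrBr (mulrC _ (f u)) !mulrBr (mulrC (f u)) => h; lra.
Qed.

Lemma exp_mean_window_norm c M f u v y :
  0 < y -> 0 <= u -> u <= v -> locbd f ->
  (forall t, u <= t < v -> `|f t - c| <= M) ->
  `|exp_mean (fun t => (step u t - step v t) * f t) y
    - c * (expR (- (y * u)) - expR (- (y * v)))|
  <= M * (expR (- (y * u)) - expR (- (y * v))).
Proof.
move=> y0 u0 uv bf fM.
have h1 := @exp_mean_window_ge (c - M) f u v y y0 u0 uv bf.
have h2 := @exp_mean_window_ge (- c - M) (fun t => - 1 * f t) u v y y0 u0 uv (locbdZ _ bf).
have e : exp_mean (fun t => (step u t - step v t) * (- 1 * f t)) y =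
   - 1 * exp_mean (fun t => (step u t - step v t) * f t) y.
  rewrite -exp_meanZ//; last exact: subexp_window.
  by apply: eq_exp_mean => t _; ring.
rewrite e in h2.
have {}h1 := h1 _; have {}h2 := h2 _.
rewrite ler_norml; apply/andP; split.
  have : (c - M) * (expR (- (y * u)) - expR (- (y * v))) <=
     exp_mean (fun t => (step u t - step v t) * f t) y.
    by apply: h1 => t /fM; rewrite ler_norml => /andP[? ?]; lra.
  by lra.
have : (- c - M) * (expR (- (y * u)) - expR (- (y * v))) <=
     - 1 * exp_mean (fun t => (step u t - step v t) * f t) y.
  by apply: h2 => t /fM; rewrite ler_norml => /andP[? ?]; lra.
by lra.
Qed.

(** Cut the window at the tag t. With g replaced by g(u) on [u, t[ and by g(v) on [t, v[, the
    by-parts increment is exactly the Riemann-Stieltjes term; the replacement costs the variation of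
    g times a mass of at most y (v - u). *)
Lemma RS_term_exp g V u t v y : 0 < y -> 0 <= u -> u <= t -> t <= v ->
  locbd g ->
  (forall x z, u <= x -> x <= z -> z <= v -> `|g z - g x| <= V z - V x) ->
  `|expR (- (y * t)) * (g v - g u)
    - (stieltjes_exp g y v - stieltjes_exp g y u)| <= y * (v - u) * (V v - V u).
Proof.
move=> y0 u0 ut tv bg gV; have t0 := le_trans u0 ut.
have ndV x z : u <= x -> x <= z -> z <= v -> V x <= V z.
  by move=> ux xz zv; rewrite -subr_ge0 (le_trans _ (gV x z ux xz zv)).
have -> : expR (- (y * t)) * (g v - g u) -
    (stieltjes_exp g y v - stieltjes_exp g y u) =
  - (exp_mean (fun z => (step u z - step t z) * g z) y
      - g u * (expR (- (y * u)) - expR (- (y * t)))) +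
  - (exp_mean (fun z => (step t z - step v z) * g z) y
      - g v * (expR (- (y * t)) - expR (- (y * v)))).
  have -> : stieltjes_exp g y v - stieltjes_exp g y u =
    (stieltjes_exp g y t - stieltjes_exp g y u) +
    (stieltjes_exp g y v - stieltjes_exp g y t) by ring.
  by rewrite !stieltjes_exp_incr//; ring.
apply: le_trans (ler_normD _ _) _; rewrite !normrN.
have h1 := @exp_mean_window_norm (g u) (V v - V u) g u t y y0 u0 ut bg.
have h2 := @exp_mean_window_norm (g v) (V v - V u) g t v y y0 t0 tv bg.
apply: le_trans (lerD (h1 _) (h2 _)) _.
- move=> z /andP[uz /ltW zt]; have zv := le_trans zt tv.
  by rewrite (le_trans (gV _ _ _ _ _))// lerD2r ndV.
- move=> z /andP[tz /ltW zv]; have uz := le_trans ut tz.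
  by rewrite distrC (le_trans (gV _ _ _ _ _))// lerD2l lerN2 ndV.
have uv := le_trans ut tv.
have := expR_window_le y0 u0 uv.
have : 0 <= V v - V u by rewrite subr_ge0 ndV.
move=> V0 ad; rewrite -mulrDr addrA subrK mulrC; by rewrite ler_wpM2r.
Qed.

(** The termwise errors add up to at most mesh times y times the variation, because the increments
    of V telescope. *)
Lemma is_RS_integral_exp g V y b : 0 < y -> 0 <= b -> locbd g ->
  (forall u v, 0 <= u -> u <= v -> v <= b -> `|g v - g u| <= V v - V u) ->
  is_RS_integral (fun t => expR (- (y * t))) g 0 b (stieltjes_exp g y b).
Proof.
move=> y0 b0 bg gV e e0.
have V0 : 0 <= V b - V 0 by apply: le_trans (gV 0 b _ _ _).
have yV : 0 < y * (V b - V 0) + 1 by rewrite ltr_wpDl// mulr_ge0// ltW.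
(* The 1 keeps the denominator positive when V b = V 0 and makes the final inequality strict. *)
exists (e / (y * (V b - V 0) + 1)); first by rewrite divr_gt0.
set d := e / _ => s t sp ts tag.
have d0 : 0 < d by rewrite divr_gt0.
(* The left endpoint is freed so that induction can remove the first cell of the partition. *)
suff {e0} H : forall (a : R) (s t : seq R), 0 <= a -> itv_partition a b s -> size t = size s ->
   (forall n, (n < size s)%N -> [/\ nth b (a :: s) n <= nth 0 t n,
         nth 0 t n <= nth b (a :: s) n.+1 &
         nth b (a :: s) n.+1 - nth b (a :: s) n < d]) ->
   `|RS_sum (fun t => expR (- (y * t))) g a b s t
     - (stieltjes_exp g y b - stieltjes_exp g y a)| <= y * d * (V b - V a).
  have /= := H 0 s t (lexx 0) sp ts tag.
  have -> : stieltjes_exp g y 0 = 0.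
    rewrite /stieltjes_exp mulr0 oppr0 expR0 mul1r subrr add0r.
    rewrite (@eq_exp_mean _ _ (fun=> 0)) ?exp_mean_cst// => u u0.
    by rewrite /step u0 subrr mul0r.
  rewrite subr0 => /le_lt_trans; apply.
  have -> : e = d * (y * (V b - V 0) + 1) by rewrite /d divfK// gt_eqF.
  nra.
move=> a {ts tag sp} {}s {t}.
elim: s a => [|x s IH] a t a0 sp.
  move/size0nil => -> _; rewrite (itv_partition_nil sp).
  by rewrite /RS_sum big_nil !subrr normr0 mulr0.
case: t => [//|t0 t] /= [ts] tag.
have [/= /andP[ax _] _] := sp.
have sp' := itv_partition_cons sp.
have xb : x <= b := itv_partition_le sp'.
have [/= at0 t0x xad] := tag 0%N isT.
have x0 : 0 <= x by rewrite (le_trans a0)// ltW.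
have {}IH := IH x t x0 sp' ts (fun n h => tag n.+1 h).
have h := @RS_term_exp g V a t0 x y y0 a0 at0 t0x bg.
have {}h := h (fun u v au uv vx => gV u v (le_trans a0 au) uv (le_trans vx xb)).
have -> : RS_sum (fun t => expR (- (y * t))) g a b (x :: s) (t0 :: t) =
  expR (- (y * t0)) * (g x - g a) + RS_sum (fun t => expR (- (y * t))) g x b s t.
  by rewrite /RS_sum big_nat_recl.
have -> : forall p q, p + q - (stieltjes_exp g y b - stieltjes_exp g y a) =
  (p - (stieltjes_exp g y x - stieltjes_exp g y a)) +
  (q - (stieltjes_exp g y b - stieltjes_exp g y x)) by move=> *; ring.
apply: le_trans (ler_normD _ _) _; apply: le_trans (lerD h IH) _.
have Vxa : 0 <= V x - V a by apply: le_trans (gV a x _ _ _) => //; exact: ltW.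
have : y * (x - a) * (V x - V a) <= y * d * (V x - V a).
  by rewrite ler_wpM2r// ler_wpM2l// ?(ltW y0)// ltW.
by lra.
Qed.

Lemma fine_tagged_partition (a h d : R) N : 0 < h -> h < d ->
  exists s t : seq R, [/\ itv_partition a (a + h *+ N) s, size t = size s &
    forall n, (n < size s)%N ->
         [/\ nth (a + h *+ N) (a :: s) n <= nth 0 t n,
             nth 0 t n <= nth (a + h *+ N) (a :: s) n.+1 &
             nth (a + h *+ N) (a :: s) n.+1 - nth (a + h *+ N) (a :: s) n < d]].
Proof.
move=> h0 hd; elim: N a => [|N IH] a.
  by exists [::], [::]; split => //; split; rewrite //= mulr0n addr0.
have [s [t [[/= p1 p2] st tag]]] := IH (a + h).
have e : a + h + h *+ N = a + h *+ N.+1 by rewrite -addrA -mulrS.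
rewrite e in p1 p2 tag.
exists ((a + h) :: s), (a :: t); split => /=.
- by split => //=; rewrite ltrDl h0.
- by rewrite st.
- case=> [|n] /=; last exact: tag.
  by rewrite lexx lerDl ltW//= addrAC subrr add0r.
Qed.

(** Some tagged partition is finer than both moduli, and its single sum lies within half of |I - J|
    of each value. Uniqueness identifies what [xget] selects. *)
Lemma is_RS_integral_unique f g a b I J : a <= b ->
  is_RS_integral f g a b I -> is_RS_integral f g a b J -> I = J.
Proof.
move=> ab hI hJ; apply/eqP; rewrite -subr_eq0 -normr_le0 leNgt; apply/negP => IJ.
have e0 : 0 < `|I - J| / 2 by rewrite divr_gt0.
have [d d0 dI] := hI _ e0; have [d' d'0 dJ] := hJ _ e0.
suff [s [t [sp st tag]]] : exists s t : seq R, [/\ itv_partition a b s, size t = size s &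
    forall n, (n < size s)%N ->
         [/\ nth b (a :: s) n <= nth 0 t n,
             nth 0 t n <= nth b (a :: s) n.+1 &
             nth b (a :: s) n.+1 - nth b (a :: s) n < Num.min d d']].
  have h1 := dI s t sp st; have h2 := dJ s t sp st.
  have {}h1 : `|RS_sum f g a b s t - I| < `|I - J| / 2.
    by apply: h1 => n /tag[? ?]; rewrite lt_min => /andP[].
  have {}h2 : `|RS_sum f g a b s t - J| < `|I - J| / 2.
    by apply: h2 => n /tag[? ?]; rewrite lt_min => /andP[].
  have := ler_distD (RS_sum f g a b s t) I J; rewrite (distrC I (RS_sum _ _ _ _ _ _)) => h3.
  by lra.
move: ab; rewrite le_eqVlt => /predU1P[<-|ab].
  by exists [::], [::]; split => //; split => /=.
have m0 : 0 < Num.min d d' by rewrite lt_min d0.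
(* Number of equal cells that makes the mesh (b - a) / N smaller than both moduli. *)
pose N := (Num.truncn ((b - a) / Num.min d d')).+1.
have N0 : (0 : R) < N%:R by rewrite ltr0n.
have hb : a + ((b - a) / N%:R) *+ N = b.
  by rewrite -[_ *+ N]mulr_natr divfK ?gt_eqF//; ring.
have := @fine_tagged_partition a ((b - a) / N%:R) (Num.min d d') N.
rewrite hb; apply; first by rewrite divr_gt0// subr_gt0.
by rewrite ltr_pdivrMr// mulrC -ltr_pdivrMr// /N truncnS_gt.
Qed.

Lemma RS_integral_exp g V y b : 0 < y -> 0 <= b -> locbd g ->
  (forall u v, 0 <= u -> u <= v -> v <= b -> `|g v - g u| <= V v - V u) ->
  RS_integral (fun t => expR (- (y * t))) g 0 b = stieltjes_exp g y b.
Proof.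
move=> y0 b0 bg gV; have h := is_RS_integral_exp y0 b0 bg gV.
rewrite /RS_integral; case: xgetP => [I _ hI|/(_ _ h)//].
exact: is_RS_integral_unique hI h.
Qed.

End StieltjesByParts.

(** * Lower bounds for Cesaro limits *)

Section CesaroLimits.
Context {R : realType}.
Implicit Types (f G : R -> R) (x y t l m X : R).
Notation mu := (@lebesgue_measure R).

Lemma cvgy0P f : f x @[x --> +oo] --> (0 : R) <->
  (forall e, 0 < e -> exists X, forall x, X <= x -> `|f x| <= e).
Proof.
split=> [/cvgr0Pnorm_le fl e e0|fl].
  have [X [_ Xf]] := fl e e0; exists (X + 1) => x Xx; apply: Xf.
  by rewrite (lt_le_trans _ Xx)// ltrDl.
apply/cvgr0Pnorm_le => e e0; have [X Xf] := fl e e0.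
by exists X; split; [exact: num_real|move=> x /ltW; exact: Xf].
Qed.

Lemma cvg0rP f : f y @[y --> 0^'+] --> (0 : R) <->
  (forall e, 0 < e -> exists2 d, 0 < d & forall y, 0 < y -> y <= d -> `|f y| <= e).
Proof.
split=> [/cvgr0Pnorm_le fl e e0|fl].
  have [d /= d0 df] := fl e e0; exists (d / 2); first by rewrite divr_gt0.
  move=> y y0 yd; apply: df => //=; rewrite sub0r normrN gtr0_norm//.
  by rewrite (le_lt_trans yd)// ltr_pdivrMr// ltr_pMr// ltr1n.
apply/cvgr0Pnorm_le => e e0; have [d d0 df] := fl e e0.
exists d => //= y /=; rewrite sub0r normrN => yd y0; apply: df => //.
by rewrite (le_trans _ (ltW yd))// ler_norm.
Qed.

Lemma integral_subX x k : 0 < x ->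
  \int[mu]_(t in `[0, x]) ((x - t) ^+ k) = x ^+ k.+1 / k.+1%:R.
Proof.
move=> x0; rewrite /Rintegral.
have h t : is_derive t 1 (fun u : R => x - u) (- 1).
  by apply: is_derive_eq; rewrite /GRing.scale /= ; ring.
have E n : (fun u : R => x - u) ^+ n = (fun u => (x - u) ^+ n).
  by apply/funext => u; rewrite fctE.
have cX n : continuous (fun u : R => (x - u) ^+ n).
  move=> t; rewrite -E; apply/differentiable_continuous/derivable1_diffP.
  by case: (is_deriveX n (h t)).
pose F := fun u : R => (- k.+1%:R^-1) * (x - u) ^+ k.+1.
have d t : is_derive t 1 F ((x - t) ^+ k).
  have h2 := is_deriveZ (- k.+1%:R^-1) (is_deriveX k.+1 (h t)).
  rewrite E in h2; apply: is_derive_eq h2 _; rewrite /GRing.scale /=.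
  by rewrite mulrN1 mulrN mulNr opprK mulrA mulVf ?mul1r// pnatr_eq0.
have c : continuous F.
  by move=> t; apply/differentiable_continuous/derivable1_diffP; case: (d t).
rewrite (@continuous_FTC2 _ _ F)//.
- by rewrite /F /= subrr expr0n /= mulr0 sub0r subr0 mulNr opprK mulrC.
- by apply: continuous_subspaceT; exact: cX.
- split.
  + by move=> t _; case: (d t).
  + by apply: cvg_at_right_filter; exact: c.
  + by apply: cvg_at_left_filter; exact: c.
- by move=> t _; rewrite derive1E; case: (d t).
Qed.

Lemma measurable_subX x k (D : set R) : measurable D ->
  measurable_fun D (fun t => (x - t) ^+ k).
Proof. move=> mD; apply: measurable_funX; exact: measurable_funB. Qed.

Lemma integrable_locbd f x : locbd f ->
  mu.-integrable `[0, x] (EFin \o f).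
Proof.
move=> [mf bf]; have [K fK] := bf x.
apply: measurable_bounded_integrable => //.
- by rewrite /= lebesgue_measure_itv /=; case: ifP => // _; rewrite ltry.
- apply: measurable_funS mf => //.
  by move=> t /=; rewrite !in_itv/= andbT => /andP[].
- exists `|K|; split; first exact: num_real.
  move=> M KM t /=; rewrite in_itv /= => tx.
  by rewrite (le_trans (fK _ tx))// (le_trans (ler_norm _))// ltW.
Qed.

Lemma locbd_subXM f x k : locbd f -> locbd (fun t => (x - t) ^+ k * f t).
Proof.
move=> [mf bf]; split.
  by apply: measurable_funM => //; exact: measurable_subX.
move=> b; have [K fK] := bf b; exists ((`|x| + `|b|) ^+ k * K) => t tb.
have /andP[t0 tb'] := tb.
rewrite normrM ler_pM ?fK// normrX lerXn2r ?nnegrE ?addr_ge0//.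
rewrite (le_trans (ler_normB _ _))// lerD2l ger0_norm//.
by rewrite (le_trans tb')// ler_norm.
Qed.

Lemma locbd_subX x k : locbd (fun t => (x - t) ^+ k).
Proof.
have := @locbd_subXM (fun=> 1) x k (locbd_cst 1).
by congr locbd; apply/funext => t /=; rewrite mulr1.
Qed.

(* Splitting the k-th primitive at a point beyond which [m <= G]: the initial
   part contributes only O(x^k'), which is negligible against x^(k'+1). *)
Lemma cesaro_iter_ge G k m X : 0 <= X -> locbd G ->
  (forall x, X <= x -> m <= G x) ->
  exists K, forall x, X < x ->
    m * x ^+ k.+1 / k.+1`!%:R - K * x ^+ k <= cesaro_iter G k.+1 x.
Proof.
move=> X0 bG mG.
have bGm : locbd (fun t => G t - m) by apply: locbdB => //; exact: locbd_cst.
have [M GM] := bGm.2 X.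
exists (M * X / k`!%:R) => x Xx; have x0 := le_lt_trans X0 Xx.
pose f t := (x - t) ^+ k * (G t - m).
have bf : locbd f by exact: locbd_subXM.
have M0 : 0 <= M by rewrite (le_trans (normr_ge0 _) (GM 0 _))// lexx.
have If : - (x ^+ k * M) * X <= \int[mu]_(t in `[0, X]) f t.
  have -> : - (x ^+ k * M) * X = \int[mu]_(t in `[0, X]) (- (x ^+ k * M)).
    rewrite Rintegral_cst; last exact: measurable_itv.
    rewrite /= lebesgue_measure_itv /= lte_fin.
    by case: ltgtP X0 => //= [_|<-] _; rewrite ?subr0.
  apply: le_Rintegral.
  - exact: measurable_itv.
  - by apply: integrable_locbd; exact: locbd_cst.
  - exact: integrable_locbd.
  - move=> t /=; rewrite in_itv/= => /andP[t0 tX].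
    have := GM t; rewrite t0 tX => /(_ isT) h.
    have : `|f t| <= x ^+ k * M.
      rewrite /f normrM ler_pM// normrX lerXn2r ?nnegrE ?(ltW x0)//.
      by rewrite ger0_norm ?lerBlDr ?lerDl ?subr_ge0// (le_trans tX)// ltW.
    by rewrite ler_norml => /andP[].
have If2 : \int[mu]_(t in `[0, X]) f t <= \int[mu]_(t in `[0, x]) f t.
  rewrite -subr_ge0 Rintegral_itvB ?bnd_simp ?(ltW Xx)//; last exact: integrable_locbd.
  apply: Rintegral_ge0 => t /=; rewrite in_itv /= => /andP[Xt tx].
  by rewrite mulr_ge0 ?exprn_ge0 ?subr_ge0// mG// ltW.
have -> : cesaro_iter G k.+1 x = k`!%:R^-1 *
    (\int[mu]_(t in `[0, x]) f t + m * (x ^+ k.+1 / k.+1%:R)).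
  rewrite /cesaro_iter -integral_subX// -RintegralZl//; last first.
    by apply: integrable_locbd; exact: locbd_subX.
  rewrite -RintegralD; [|exact: measurable_itv|exact: integrable_locbd|].
    by congr (_ * _); apply: eq_Rintegral => t _; rewrite /f; ring.
  by apply: integrable_locbd; apply: locbdZ; exact: locbd_subX.
rewrite factS natrM.
have fk0 : (0 : R) < k`!%:R by rewrite ltr0n fact_gt0.
rewrite mulrDr -lerBlDr -!mulrA.
have -> : m * (x ^+ k.+1 * (k.+1%:R * k`!%:R)^-1) - M * (X * (k`!%:R^-1 * x ^+ k)) -
   k`!%:R^-1 * (m * (x ^+ k.+1 * k.+1%:R^-1)) = k`!%:R^-1 * (- (x ^+ k * M) * X).
  by field; rewrite gt_eqF// nat1r pnatr_eq0.
by rewrite ler_wpM2l ?invr_ge0 ?(ltW fk0)// (le_trans If).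
Qed.

(** For positive order, the k-th primitive is at least m x^k / k! - O(x^(k-1)) and also l x^k / k! +
    o(x^k); compare leading coefficients. This is how (C) limits of unknown order are exploited
    later. *)
Lemma C_lim_ge G l m X : locbd G -> C_lim G l ->
  (forall x, X <= x -> m <= G x) -> m <= l.
Proof.
move=> bG [k /cvgy0P Gl] mG; rewrite leNgt; apply/negP => lm.
case: k Gl => [|k] Gl.
  have [Y YG] := Gl ((m - l) / 2) ltac:(by rewrite divr_gt0// subr_gt0).
  have := mG (Num.max X Y); rewrite le_max lexx => /(_ isT).
  have := YG (Num.max X Y); rewrite le_max lexx orbT => /(_ isT).
  rewrite /= expr0 fact0 !divr1 mulr1 ler_norml => /andP[_]; lra.
have [||K GK] := @cesaro_iter_ge G k m (Num.max 0 X) _ bG _.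
- by rewrite le_max lexx.
- by move=> x; rewrite ge_max => /andP[_]; exact: mG.
have fk0 : (0 : R) < k.+1`!%:R by rewrite ltr0n fact_gt0.
have e0 : 0 < (m - l) / k.+1`!%:R by rewrite divr_gt0// subr_gt0.
have [Y YG] := Gl ((m - l) / k.+1`!%:R / 2) ltac:(by rewrite divr_gt0).
set e := (m - l) / _ in e0 YG.
(* Beyond both thresholds and with 4 |K| <= e x, so that the correction K cannot fill the gap e x /
   2. *)
pose x := Num.max (Num.max 0 X) Y + 1 + `|K| * 4 / e.
have Kx : 0 <= `|K| * 4 / e by apply: divr_ge0; [exact: mulr_ge0|exact: ltW].
have m1 : Num.max 0 X <= Num.max (Num.max 0 X) Y by rewrite le_max lexx.
have m2 : Y <= Num.max (Num.max 0 X) Y by rewrite le_max lexx orbT.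
have m3 : 0 <= Num.max 0 X by rewrite le_max lexx.
have x0 : 0 < x by rewrite /x; lra.
have xk : 0 < x ^+ k by rewrite exprn_gt0.
have := GK x ltac:(rewrite /x; lra); have := YG x ltac:(rewrite /x; lra).
rewrite ler_norml => /andP[_]; rewrite ler_pdivrMr ?exprn_gt0// => h1 h2.
have h3 : (m - l) * x ^+ k.+1 / k.+1`!%:R - K * x ^+ k <= e / 2 * x ^+ k.+1 by lra.
have h4 : e * x - K <= e / 2 * x.
  by rewrite -(ler_pM2r xk); move: h3; rewrite /e exprS => h3; lra.
have : `|K| * 4 <= e * x.
  have : `|K| * 4 / e <= x by rewrite /x; lra.
  by rewrite ler_pdivrMr// (mulrC x).
have := ler_norm K.
have ex : 0 < e * x by rewrite mulr_gt0.
have := normr_ge0 K.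
by lra.
Qed.

End CesaroLimits.

(** * The (C) Laplace transform as an exponential mean *)

Section LaplaceAsMean.
Context {R : realType}.
Implicit Types (f g s : R -> R) (x y t u v e : R).

(** Additivity of the total variation measured from 0. *)
Lemma locally_bv_variation s : locally_bv s ->
  exists V : R -> R, forall u v, 0 <= u -> u <= v -> `|s v - s u| <= V v - V u.
Proof.
move=> bs; exists (fun x => fine (total_variation 0 x s)) => u v u0 uv.
have v0 := le_trans u0 uv.
have fu : total_variation 0 u s \is a fin_num by apply/bounded_variationP => //; exact: bs.
have fuv : total_variation u v s \is a fin_num by apply/bounded_variationP => //; exact: bs.
rewrite (total_variationD s u0 uv) fineD// addrAC subrr add0r.
by rewrite -lee_fin fineK// total_variation_ge.
Qed.

(** Jordan decomposition: s = V - (V - s), with both terms nondecreasing on the half line. *)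
Lemma variation_locbd s (V : R -> R) :
  (forall u v, 0 <= u -> u <= v -> `|s v - s u| <= V v - V u) -> locbd s.
Proof.
move=> sV.
have h : forall t, 0 <= t -> V t - (V t - s t) = s t by move=> t _; ring.
apply: (eq_locbd h); apply: locbdB; apply: nondecreasing_locbd => u v u0 uv.
  by rewrite -subr_ge0 (le_trans _ (sV _ _ u0 uv)).
have := sV _ _ u0 uv; rewrite ler_norml => /andP[_]; lra.
Qed.

Lemma subexpM f g : subexp f -> subexp g -> subexp (fun t => f t * g t).
Proof.
move=> [mf fe] [mg ge]; split; first exact: measurable_funM.
move=> e e0; have e2 : 0 < e / 2 by rewrite divr_gt0.
have [K fK] := fe _ e2; have [L gL] := ge _ e2.
exists (K * L) => t t0; rewrite normrM.
have -> : K * L * expR (e * t) = (K * expR (e / 2 * t)) * (L * expR (e / 2 * t)).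
  by rewrite mulrACA -expRD; congr (_ * expR _); field.
by rewrite ler_pM ?fK ?gL.
Qed.

Lemma subexp_id : subexp (fun t : R => t).
Proof.
split; first exact: measurable_id.
move=> e e0; exists e^-1 => t t0.
rewrite ger0_norm// -ler_pdivrMl ?invr_gt0// invrK.
by have := expR_ge1Dx (e * t); lra.
Qed.

Lemma locbd_id : locbd (fun t : R => t).
Proof. exact: nondecreasing_locbd. Qed.

Lemma stieltjes_expD f g c x y : 0 < y -> 0 <= x -> locbd f -> locbd g ->
  stieltjes_exp (fun t => f t + c * g t) y x =
  stieltjes_exp f y x + c * stieltjes_exp g y x.
Proof.
move=> y0 x0 bf bg; rewrite /stieltjes_exp.
have w h : exp_mean (fun t => (1 - step x t) * h t) y =
    exp_mean (fun t => (step 0 t - step x t) * h t) y.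
  by apply: eq_exp_mean => t t0; rewrite {2}/step t0.
rewrite !w.
have -> : exp_mean (fun t => (step 0 t - step x t) * (f t + c * g t)) y =
  exp_mean (fun t => (step 0 t - step x t) * f t) y +
  c * exp_mean (fun t => (step 0 t - step x t) * g t) y.
  rewrite -exp_meanZ//; last exact: subexp_window.
  rewrite -exp_meanD//; try exact: subexp_window.
    by apply: eq_exp_mean => t _; ring.
  by apply: subexpZ; exact: subexp_window.
ring.
Qed.

Lemma stieltjes_exp_nondecreasing f y u v : 0 < y -> 0 <= u -> u <= v ->
  locbd f -> (forall t, u <= t -> t <= v -> f u <= f t) ->
  stieltjes_exp f y u <= stieltjes_exp f y v.
Proof.
move=> y0 u0 uv bf fu; rewrite -subr_ge0.
apply: le_trans (stieltjes_exp_ge y0 u0 uv bf _).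
  by rewrite mulr_ge0 ?expR_ge0// subr_ge0 fu.
by move=> t /andP[ut tv]; rewrite fu// ltW.
Qed.

(** The Jordan decomposition passes to the integrals, since the Stieltjes integral against a
    nondecreasing function is nondecreasing in x. This supplies the measurability and boundedness
    that [C_lim_ge] asks for. *)
Lemma locbd_stieltjes_exp s (V : R -> R) y : 0 < y ->
  (forall u v, 0 <= u -> u <= v -> `|s v - s u| <= V v - V u) ->
  locbd (stieltjes_exp s y).
Proof.
move=> y0 sV.
have bs := variation_locbd sV.
have ndV u v : 0 <= u -> u <= v -> V u <= V v.
  by move=> u0 uv; rewrite -subr_ge0 (le_trans _ (sV _ _ u0 uv)).
have ndW u v : 0 <= u -> u <= v -> V u + -1 * s u <= V v + -1 * s v.
  by move=> u0 uv; have := sV _ _ u0 uv; rewrite ler_norml => /andP[_]; lra.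
have bV := nondecreasing_locbd ndV; have bW := nondecreasing_locbd ndW.
have h : forall x, 0 <= x -> stieltjes_exp V y x
    - stieltjes_exp (fun t => V t + -1 * s t) y x = stieltjes_exp s y x.
  by move=> x x0; rewrite stieltjes_expD//; ring.
apply: (eq_locbd h); apply: locbdB; apply: nondecreasing_locbd => u v u0 uv;
  apply: stieltjes_exp_nondecreasing => // t ut _; [exact: ndV|exact: ndW].
Qed.

(** Controls the cost of adding a linear term to s to make it monotone. *)
Lemma stieltjes_exp_id_le y : 0 < y ->
  exists M, forall x, 0 <= x -> stieltjes_exp (fun t : R => t) y x <= M.
Proof.
move=> y0; have [K tK] := subexp_id.2 y y0.
exists (K + exp_mean (fun t : R => t) y) => x x0.
rewrite /stieltjes_exp subr0 lerD//.
  rewrite expRN mulrC ler_pdivrMr ?expR_gt0//.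
  by rewrite (le_trans _ (tK x x0))// ler_norm.
have w : exp_mean (fun t => (1 - step x t) * t) y =
    exp_mean (fun t => (step 0 t - step x t) * t) y.
  by apply: eq_exp_mean => t t0; rewrite {2}/step t0.
rewrite w; apply: le_exp_mean => //; first exact: (subexp_window x0 locbd_id).
  exact: subexp_id.
move=> t t0; have /andP[_ h] := window_range t x0.
by rewrite -[leRHS]mul1r ler_wpM2r.
Qed.

Lemma laplace_partialE s (V : R -> R) y x : 0 < y -> 0 <= x ->
  (forall u v, 0 <= u -> u <= v -> `|s v - s u| <= V v - V u) ->
  laplace_partial s y x = stieltjes_exp s y x.
Proof.
move=> y0 x0 sV; rewrite /laplace_partial x0 (@RS_integral_exp _ _ V)//.
  exact: variation_locbd sV.
by move=> u v u0 uv _; exact: sV.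
Qed.

(* Up to the bounded Stieltjes integral of [C * t], the partial Laplace
   integrals are nondecreasing beyond [B]; a (C,k) limit bounds them, hence
   bounds [expR (- (y * x)) * s x]. *)
Lemma subexp_laplace_C s (V : R -> R) (B C : R) :
  (forall u v, 0 <= u -> u <= v -> `|s v - s u| <= V v - V u) ->
  0 <= B -> 0 <= C ->
  (forall u v, B <= u -> u <= v -> s u + C * u <= s v + C * v) ->
  (forall y, 0 < y -> laplace_C_exists s y) -> subexp s.
Proof.
move=> sV B0 C0 nds exL; have bs := variation_locbd sV.
split; first exact: bs.1.
move=> y y0; have [l Gl] := exL y y0.
have [M idM] := stieltjes_exp_id_le y0.
pose h t := s t + C * t.
have bh : locbd h by apply: locbdD => //; apply: locbdZ; exact: locbd_id.
have hE x : 0 <= x -> stieltjes_exp h y x =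
    stieltjes_exp s y x + C * stieltjes_exp (fun t : R => t) y x.
  by move=> x0; rewrite -stieltjes_expD//; exact: locbd_id.
have bG : locbd (laplace_partial s y).
  apply: eq_locbd (locbd_stieltjes_exp y0 sV) => x x0.
  by rewrite (laplace_partialE y0 x0 sV).
have hl x : B <= x -> stieltjes_exp h y x <= l + C * M.
  move=> Bx; have x0 := le_trans B0 Bx; rewrite -lerBlDr.
  apply: (C_lim_ge bG Gl (X := x)) => z xz; have z0 := le_trans x0 xz.
  rewrite (laplace_partialE y0 z0 sV).
  have := stieltjes_exp_nondecreasing y0 x0 xz bh (fun t xt _ => nds x t Bx xt).
  rewrite (hE z)//.
  have := ler_wpM2l C0 (idM z z0); lra.
have [K tK] := subexp_id.2 y y0; have [Kb sK] := bs.2 B.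
(* In order: the bound on e^{-yx} (h(x) - h(B)), the base value h(B), the removal of C x, and the
   values of s on [0, B]. *)
exists (`|l + C * M - stieltjes_exp h y B| + `|h B| + C * K + `|Kb|) => x x0.
have e1 : 1 <= expR (y * x) by rewrite -expR0 ler_expR mulr_ge0// ltW.
have K0 : 0 <= K.
  have := tK 0 (lexx 0); rewrite normr0 mulr0 expR0 mulr1; exact.
have CK : 0 <= C * K by rewrite mulr_ge0.
have grow c : 0 <= c -> c <= c * expR (y * x) by move=> c0; rewrite ler_peMr.
have g1 := grow _ (normr_ge0 (h B)); have g2 := grow _ (normr_ge0 Kb).
have g3 := grow _ (normr_ge0 (l + C * M - stieltjes_exp h y B)).
have g4 := grow _ CK.
have n1 := normr_ge0 (h B); have n2 := normr_ge0 Kb.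
have n3 := normr_ge0 (l + C * M - stieltjes_exp h y B).
rewrite !mulrDl; have [xB|Bx] := leP x B.
  have : `|s x| <= `|Kb| by rewrite (le_trans (sK x _)) ?x0 ?ler_norm.
  by lra.
have hx := stieltjes_exp_ge y0 B0 (ltW Bx) bh.
have {}hx := hx (fun t ht => nds B t (lexx B) (andP ht).1).
have h1 := le_trans hx (lerD (hl x (ltW Bx)) (lexx _)).
have h2 : h x - h B <= `|l + C * M - stieltjes_exp h y B| * expR (y * x).
  rewrite -ler_pdivrMr ?expR_gt0// -expRN mulrC.
  by rewrite (le_trans h1)// ler_norm.
have h3 : h B <= h x := nds B x (lexx B) (ltW Bx).
have h4 := ler_wpM2l C0 (le_trans (ler_norm x) (tK x x0)).
have h5 : 0 <= C * x by rewrite mulr_ge0.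
have := ler_norm (h B); have := ler_norm (- h B); rewrite normrN.
have -> : s x = h x - C * x by rewrite /h addrK.
by move=> ? ?; rewrite ler_norml; apply/andP; split; lra.
Qed.

(** The function (t + 1) s(t) is subexponential too, and t + 1 >= x + 1 on the tail; this gains the
    factor 1 / (x + 1) in both the boundary term and the tail mean. *)
Lemma stieltjes_exp_cvg s y : 0 < y -> subexp s ->
  exists K, forall x, 0 <= x ->
    `|stieltjes_exp s y x - (exp_mean s y - s 0)| <= K / (x + 1).
Proof.
move=> y0 ss.
have s1 : subexp (fun t => (t + 1) * s t).
  by apply: subexpM => //; apply: subexpD; [exact: subexp_id|exact: subexp_cst].
have [K sK] := s1.2 y y0.
pose W := exp_mean (fun t => `|(t + 1) * s t|) y.
exists (K + W) => x x0; have x1 : 0 < x + 1 by rewrite ltr_wpDl.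
have ssx : subexp (fun t => step x t * s t).
  by apply: subexpM => //; exact: subexp_step.
have -> : stieltjes_exp s y x - (exp_mean s y - s 0) =
  expR (- (y * x)) * s x - exp_mean (fun t => step x t * s t) y.
  rewrite /stieltjes_exp.
  have -> : exp_mean (fun t => (1 - step x t) * s t) y =
     exp_mean s y - exp_mean (fun t => step x t * s t) y.
    by rewrite -exp_meanB//; apply: eq_exp_mean => t _; ring.
  ring.
rewrite (le_trans (ler_normB _ _))// mulrDl lerD//.
  rewrite ler_pdivlMr// normrM (ger0_norm (expR_ge0 _)) -mulrA mulrC expRN.
  rewrite ler_pdivrMr ?expR_gt0//; have := sK x x0.
  by rewrite normrM (ger0_norm (ltW x1)) mulrC.
rewrite (_ : W / (x + 1) = exp_mean (fun t => (x + 1)^-1 * `|(t + 1) * s t|) y).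
  apply: norm_exp_mean => //; first by apply: subexpZ; exact: subexp_abs.
  move=> t t0; rewrite normrM [in leRHS]normrM mulrA ler_wpM2r//.
  rewrite mulrC ler_pdivlMr// (@ger0_norm _ (t + 1)) ?addr_ge0//.
  rewrite /step; case: (boolP (x <= t)) => xt.
    by rewrite normr1 mul1r lerD2r.
  by rewrite normr0 mul0r addr_ge0.
by rewrite exp_meanZ//; [rewrite mulrC|exact: subexp_abs].
Qed.

(** The partial integrals are eventually within e of [exp_mean s y - s 0]. Applying [C_lim_ge] to
    them and to their negatives squeezes any (C) limit, whatever its order. *)
Lemma laplace_C_exp_mean s (V : R -> R) y : 0 < y ->
  (forall u v, 0 <= u -> u <= v -> `|s v - s u| <= V v - V u) ->
  subexp s -> laplace_C_exists s y -> laplace_C s y = exp_mean s y - s 0.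
Proof.
move=> y0 sV ss exL.
(* Existence rules out the default 0 of [xget], so the selected value is a genuine (C) limit. *)
have [l Gl] : exists l, C_lim (laplace_partial s y) l /\ laplace_C s y = l.
  exists (laplace_C s y); split => //; rewrite /laplace_C.
  by case: xgetP => // hn; case: exL => l /hn.
case: Gl => Gl ->; have bG : locbd (laplace_partial s y).
  apply: eq_locbd (locbd_stieltjes_exp y0 sV) => x x0.
  by rewrite (laplace_partialE y0 x0 sV).
have [K sK] := stieltjes_exp_cvg y0 ss.
have near e : 0 < e -> forall x, Num.max 0 (`|K| / e) <= x ->
    `|laplace_partial s y x - (exp_mean s y - s 0)| <= e.
  move=> e0 x; rewrite ge_max => /andP[x0]; rewrite ler_pdivrMr// => Kx.
  rewrite (laplace_partialE y0 x0 sV) (le_trans (sK x x0))//.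
  rewrite ler_pdivrMr ?ltr_wpDl// (le_trans (ler_norm K))// mulrC.
  by rewrite (le_trans Kx)// ler_wpM2r ?(ltW e0)// lerDl.
have bGN : locbd (fun x => -1 * laplace_partial s y x) by exact: locbdZ.
have GlN : C_lim (fun x => -1 * laplace_partial s y x) (- l).
  case: Gl => k Gl; exists k; apply/cvgy0P => e e0.
  have /cvgy0P/(_ e e0)[X XG] := Gl.
  exists (Num.max 1 X) => x; rewrite ge_max => /andP[x1 Xx].
  have := XG x Xx; rewrite -normrN -mulNr opprB.
  congr (`|_ / _| <= _).
  have -> : cesaro_iter (fun x => -1 * laplace_partial s y x) k x =
      - cesaro_iter (laplace_partial s y) k x.
    case: k {Gl XG} => [|k] /=; first by rewrite mulN1r.
    rewrite -mulrN; congr (_ * _); rewrite -[RHS]mulN1r -RintegralZl//.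
      by apply: eq_Rintegral => t _; ring.
    by apply: integrable_locbd; exact: locbd_subXM.
  by ring.
apply/eqP; rewrite eq_le; apply/andP; split; apply/ler_addgt0Pr => e e0.
  have : - (exp_mean s y - s 0 + e) <= - l.
    apply: (C_lim_ge bGN GlN) => x /(near e e0).
    by rewrite ler_norml => /andP[? ?]; lra.
  by lra.
have : exp_mean s y - s 0 - e <= l.
  apply: (C_lim_ge bG Gl) => x /(near e e0).
  by rewrite ler_norml => /andP[? ?]; lra.
by lra.
Qed.

End LaplaceAsMean.

(** * Harmonic sums as a substitute for the logarithm *)

Section Harmonic.
Context {R : realType}.
Implicit Types (x y t z : R).

(** Preferred to log because it is nondecreasing on the whole line, vanishes below 1, and has a
    power series in e^{-y} as its mean. *)
Definition harmonic_sum x : R := \sum_(0 <= k < Num.truncn x) k.+1%:R^-1.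

Lemma ler_harmonic (m n : nat) : (m <= n)%N ->
  \sum_(0 <= k < m) (k.+1%:R^-1 : R) <= \sum_(0 <= k < n) k.+1%:R^-1.
Proof.
move=> mn; rewrite (big_cat_nat _ mn)//= lerDl sumr_ge0//.
Qed.

Lemma harmonic_sum_nondecreasing x y : x <= y -> harmonic_sum x <= harmonic_sum y.
Proof. by move=> xy; apply: ler_harmonic; exact: le_truncn. Qed.

Lemma harmonic_sum_ge0 x : 0 <= harmonic_sum x.
Proof. by rewrite sumr_ge0. Qed.

Lemma harmonic_sum_le t : 0 <= t -> harmonic_sum t <= t.
Proof.
move=> t0; have /andP[h _] := truncn_itv t0; apply: le_trans h.
have -> : ((Num.truncn t)%:R : R) = \sum_(0 <= k < Num.truncn t) 1.
  by rewrite sumr_const_nat subn0.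
by apply: ler_sum => k _; rewrite invf_le1// ler1n.
Qed.

Lemma subexp_harmonic_sum : subexp harmonic_sum.
Proof.
split.
  apply: nondecreasing_measurable => //; exact: harmonic_sum_nondecreasing.
move=> e e0; have [K tK] := (@subexp_id R).2 e e0; exists K => t t0.
rewrite (le_trans _ (tK t t0))// !ger0_norm ?harmonic_sum_ge0//.
exact: harmonic_sum_le.
Qed.

Lemma ln_succ_le (n : nat) : (0 < n)%N -> ln (n.+1%:R : R) <= ln n%:R + n%:R^-1.
Proof.
move=> n0; have n0' : (0 : R) < n%:R by rewrite ltr0n.
have -> : (n.+1%:R : R) = n%:R * (1 + n%:R^-1).
  by rewrite mulrDr mulr1 mulfV ?gt_eqF// -natr1.
have i0 : (0 : R) < n%:R^-1 by rewrite invr_gt0.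
have i1 : (0 : R) < 1 + n%:R^-1 by rewrite addr_gt0.
rewrite lnM ?posrE//.
by rewrite lerD2l; apply: le_ln1Dx; lra.
Qed.

Lemma ln_succ_ge (n : nat) : (0 < n)%N -> ln (n%:R : R) + n.+1%:R^-1 <= ln n.+1%:R.
Proof.
move=> n0; have n0' : (0 : R) < n%:R by rewrite ltr0n.
have n1' : (0 : R) < n.+1%:R by rewrite ltr0n.
have e : (n%:R : R) = n.+1%:R * (1 + - n.+1%:R^-1).
  by rewrite mulrDr mulr1 mulrN mulfV ?gt_eqF// -natr1 addrK.
have h : (0 : R) < 1 + - n.+1%:R^-1 by rewrite -(pmulr_rgt0 _ n1') -e.
rewrite {1}e lnM ?posrE// -addrA gerDl.
move: h; set i := n.+1%:R^-1 => h.
have l : -1 < - i by lra.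
by have := le_ln1Dx l; lra.
Qed.

Lemma harmonic_ln_cvg :
  (fun n : nat => \sum_(0 <= k < n) (k.+1%:R)^-1 - ln (n%:R : R)) @ \oo
    --> (@euler_gamma R).
Proof.
rewrite /euler_gamma.
set u := (fun n : nat => _).
(* The shift drops n = 0, where [ln 0] is only a default value and monotonicity fails. *)
suff /cvg_ex[l] : cvgn [sequence u n.+1]_n.
  by rewrite cvg_shiftS => ul; rewrite (cvg_lim _ ul).
apply: nonincreasing_is_cvgn.
  apply/nonincreasing_seqP => n /=; rewrite /u big_nat_recr//=.
  have := @ln_succ_ge n.+1 isT; set i := n.+2%:R^-1.
  set S := \sum_(0 <= k < _) _; set p := ln _; set q := ln _; lra.
have ln_le n : ln (n.+1%:R : R) <= \sum_(0 <= k < n) k.+1%:R^-1.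
  elim: n => [|n IH]; first by rewrite big_nil ln1.
  rewrite big_nat_recr//= (le_trans (@ln_succ_le n.+1 isT))//.
  by rewrite lerD2r.
exists 0 => _ [n _ <-] /=; rewrite /u subr_ge0 (le_trans (ln_le n))//.
exact: ler_harmonic.
Qed.

Lemma harmonic_sum_cvg :
  (harmonic_sum x - ln x - euler_gamma) @[x --> +oo] --> (0 : R).
Proof.
apply/cvgy0P => e e0.
have e2 : 0 < e / 2 by rewrite divr_gt0.
have /cvgrPdist_le /(_ _ e2)[N _ HN] := harmonic_ln_cvg.
(* Past 2 / e + 1 the integer part n satisfies 1 / n <= e / 2, which bounds the change of ln between
   n and x. *)
exists (Num.max N.+1%:R (2 / e + 1)) => x; rewrite ge_max => /andP[Nx ex].
have x1 : 1 <= x by rewrite (le_trans _ Nx)// ler1n.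
have x0 : 0 < x by exact: lt_le_trans x1.
set n := Num.truncn x; have /andP[nx xn] := truncn_itv (ltW x0).
have n0 : (0 < n)%N by rewrite truncn_gt0.
have n0' : (0 : R) < n%:R by rewrite ltr0n.
have Nn : (N <= n)%N by rewrite truncn_ge_nat ?(ltW x0)// (le_trans _ Nx)// ler_nat.
have := HN n Nn; rewrite distrC -/(harmonic_sum x) ler_norml => /andP[h1 h2].
have l1 : ln (n%:R : R) <= ln x by rewrite ler_ln ?posrE.
have l2 : ln x <= ln n.+1%:R by rewrite ler_ln ?posrE ?ltr0n// ltW.
have l3 := ln_succ_le n0.
have l4 : (n%:R : R)^-1 <= e / 2.
  have : 2 / e <= n%:R by move: xn; rewrite -natr1; lra.
  rewrite ler_pdivrMr// => ne.
  by rewrite -(ler_pM2l n0') mulfV ?gt_eqF//; lra.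
by rewrite ler_norml; apply/andP; split; lra.
Qed.

Lemma is_derive_log_series (N : nat) z :
  is_derive z 1 (fun z : R => \sum_(0 <= k < N) k.+1%:R^-1 * z ^+ k.+1)
    (\sum_(0 <= k < N) z ^+ k).
Proof.
elim: N => [|N IH].
  rewrite big_nil.
  rewrite (_ : (fun _ => _) = cst 0); first exact: is_derive_cst.
  by apply/funext => w; rewrite big_nil.
rewrite big_nat_recr//=.
rewrite (_ : (fun _ => _) = (fun z : R => \sum_(0 <= k < N) k.+1%:R^-1 * z ^+ k.+1)
   + (N.+1%:R^-1 \*: (id ^+ N.+1))); last first.
  by apply/funext => w; rewrite big_nat_recr//= !fctE.
apply: is_derive_eq; congr (_ + _).
rewrite /GRing.scale/= mulr1 mulrA mulVf ?mul1r// pnatr_eq0.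
Qed.

(** By the geometric sum, the left-hand function has derivative - w^N / (1 - w) and vanishes at 0;
    the mean value theorem gives the remainder. *)
Lemma log_series_bound (N : nat) z : 0 < z -> z < 1 ->
  `|\sum_(0 <= k < N) k.+1%:R^-1 * z ^+ k.+1 + ln (1 - z)| <= z ^+ N / (1 - z).
Proof.
move=> z0 z1.
pose f (w : R) := \sum_(0 <= k < N) k.+1%:R^-1 * w ^+ k.+1 + ln (1 - w).
have df (w : R) : w < 1 -> is_derive w 1 f (- (w ^+ N / (1 - w))).
  move=> w1.
  have h : is_derive w 1 (fun u : R => 1 - u) (- 1).
    by apply: is_derive_eq; rewrite /GRing.scale /= ; ring.
  have w1' : 0 < 1 - w by rewrite subr_gt0.
  have hl := @is_derive1_comp R (@ln R) (fun u : R => 1 - u) w _ _ (is_derive1_ln w1') h.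
  have hs := is_deriveD (is_derive_log_series N w) hl.
  apply: is_derive_eq hs _.
  have w0 : 1 - w != 0 by rewrite gt_eqF.
  have -> : \sum_(0 <= k < N) w ^+ k = (1 - w ^+ N) / (1 - w).
    apply: (mulIf w0); rewrite divfK// -[1 - w ^+ N]opprB subrX1 big_mkord.
    by ring.
  by field.
have fc : {within `[0, z], continuous f}.
  apply: derivable_within_continuous => w; rewrite in_itv/= => /andP[_ wz].
  by case: (df w (le_lt_trans wz z1)).
have [|c] := @MVT R f (fun w => - (w ^+ N / (1 - w))) 0 z z0 _ fc.
  by move=> w; rewrite in_itv/= => /andP[_ wz]; apply: df; exact: lt_trans z1.
rewrite in_itv/= => /andP[c0 cz].
have -> : f 0 = 0.
  rewrite /f subr0 ln1 addr0 big1// => k _; by rewrite expr0n/= mulr0.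
rewrite !subr0 -/(f z) => ->.
have c1 : 0 < 1 - c by rewrite subr_gt0 (lt_trans cz).
have z1' : 0 < 1 - z by rewrite subr_gt0.
have q0 : 0 <= c ^+ N / (1 - c) by rewrite divr_ge0 ?exprn_ge0 ?ltW.
rewrite normrM normrN (ger0_norm q0) (gtr0_norm z0).
apply: (@le_trans _ _ (c ^+ N / (1 - c))).
  by rewrite -[leRHS]mulr1 ler_wpM2l// ltW.
apply: ler_pM.
- by rewrite exprn_ge0// ltW.
- by rewrite invr_ge0 ltW.
- by rewrite lerXn2r ?nnegrE ?(ltW c0) ?(ltW z0) ?(ltW cz).
- by rewrite lef_pV2 ?posrE// lerD2l lerN2 ltW.
Qed.

Definition harmonic_steps (N : nat) t : R :=
  \sum_(0 <= k < N) k.+1%:R^-1 * step k.+1%:R t.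

Lemma subexp_harmonic_steps N : subexp (harmonic_steps N).
Proof.
elim: N => [|N IH].
  rewrite (_ : harmonic_steps _ = fun=> 0); first exact: subexp_cst.
  by apply/funext => t; rewrite /harmonic_steps big_nil.
rewrite (_ : harmonic_steps _ = fun t => harmonic_steps N t + N.+1%:R^-1 * step N.+1%:R t).
  by apply: subexpD => //; apply: subexpZ; exact: subexp_step.
by apply/funext => t; rewrite /harmonic_steps big_nat_recr.
Qed.

Lemma exp_mean_harmonic_steps N y : 0 < y ->
  exp_mean (harmonic_steps N) y =
  \sum_(0 <= k < N) k.+1%:R^-1 * expR (- y) ^+ k.+1.
Proof.
move=> y0; elim: N => [|N IH].
  rewrite big_nil (@eq_exp_mean _ _ (fun=> 0)) ?exp_mean_cst// => t _.
  by rewrite /harmonic_steps big_nil.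
rewrite big_nat_recr//= -IH -expRM_natr mulNr -exp_mean_step//.
rewrite -exp_meanZ//; last exact: subexp_step.
rewrite -exp_meanD//; first last.
- by apply: subexpZ; exact: subexp_step.
- exact: subexp_harmonic_steps.
by apply: eq_exp_mean => t _; rewrite /harmonic_steps big_nat_recr.
Qed.

(** At most t terms are missing, each at most 1 / N. An error linear in t has a mean of order 1 / N,
    so no interchange of limit and integral is needed. *)
Lemma harmonic_steps_approx (N : nat) t : (0 < N)%N -> 0 <= t ->
  0 <= harmonic_sum t - harmonic_steps N t <= N%:R^-1 * t.
Proof.
move=> N0 t0; rewrite /harmonic_sum /harmonic_steps.
set n := Num.truncn t; have /andP[nt tn] := truncn_itv t0.
have stepE k : step k.+1%:R t = (k < n)%N%:R by rewrite /step -truncn_gt_nat.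
under [X in _ - X]eq_bigr do rewrite stepE.
have N0' : (0 : R) < N%:R by rewrite ltr0n.
have [nN|Nn] := leqP n N.
  rewrite (big_cat_nat _ nN)//= [X in _ - (_ + X)](_ : _ = 0); last first.
    rewrite big_nat_cond big1// => k /andP[/andP[nk _] _].
    by rewrite ltnNge nk mulr0.
  rewrite addr0 [X in _ - X](_ : _ = \sum_(0 <= k < n) k.+1%:R^-1); last first.
    by apply: eq_big_nat => k /andP[_ ->]; rewrite mulr1.
  by rewrite subrr lexx mulr_ge0// invr_ge0 ltW.
rewrite (big_cat_nat _ (ltnW Nn))//=.
rewrite [X in _ - X](_ : _ = \sum_(0 <= k < N) k.+1%:R^-1); last first.
  by apply: eq_big_nat => k /andP[_ kN]; rewrite (ltn_trans kN Nn) mulr1.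
rewrite addrAC subrr add0r; apply/andP; split; first by rewrite sumr_ge0.
apply: (@le_trans _ _ (\sum_(N <= k < n) (N%:R^-1 : R))).
  apply: ler_sum_nat => k /andP[Nk _].
  by rewrite lef_pV2 ?posrE ?ltr0n// ler_nat ltnW// ltnS.
rewrite sumr_const_nat -[leLHS]mulr_natr ler_wpM2l ?invr_ge0 ?(ltW N0')//.
by rewrite (le_trans _ nt)// ler_nat leq_subr.
Qed.

Lemma exp_mean_harmonic_sum y : 0 < y ->
  exp_mean harmonic_sum y = - ln (1 - expR (- y)).
Proof.
move=> y0; set z := expR (- y).
have z0 : 0 < z by exact: expR_gt0.
have z1 : z < 1 by rewrite expR_lt1 oppr_lt0.
have z1' : 0 < 1 - z by rewrite subr_gt0.
pose W := exp_mean (fun t : R => t) y.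
have W0 : 0 <= W.
  have := @norm_exp_mean R (fun=> 0) (fun t => t) y y0 (subexp_cst 0) (@subexp_id R).
  by rewrite exp_mean_cst// normr0; apply.
have bound N : (0 < N)%N ->
    `|exp_mean harmonic_sum y + ln (1 - z)| <= N%:R^-1 * W + z ^+ N / (1 - z).
  move=> N0.
  have -> : exp_mean harmonic_sum y + ln (1 - z) =
     (exp_mean harmonic_sum y - exp_mean (harmonic_steps N) y) +
     (exp_mean (harmonic_steps N) y + ln (1 - z)) by ring.
  rewrite (le_trans (ler_normD _ _))// lerD//; last first.
    by rewrite exp_mean_harmonic_steps// log_series_bound.
  have sH := subexp_harmonic_sum; have sS := subexp_harmonic_steps N.
  rewrite -exp_meanB// -exp_meanZ//; last exact: subexp_id.
  apply: norm_exp_mean => //; first exact: subexpB.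
    by apply: subexpZ; exact: subexp_id.
  by move=> t t0; have /andP[h1 h2] := harmonic_steps_approx N0 t0; rewrite ger0_norm.
apply/eqP; rewrite -subr_eq0 opprK -normr_le0; apply/ler_addgt0Pr => e e0.
rewrite add0r.
have e2 : 0 < e / 2 * (1 - z) by rewrite mulr_gt0// divr_gt0.
have /cvgr0Pnorm_le /(_ _ e2)[N _ HN] : (GRing.exp z : R ^nat) @ \oo --> (0 : R).
  by apply: cvg_expr; rewrite gtr0_norm.
(* Large enough for the series remainder and the truncation error W / n to be at most e / 2 each. *)
pose n := maxn N (Num.truncn (2 * W / e)).+1.
have n0 : (0 < n)%N by rewrite leq_max ltnS leq0n orbT.
have n0' : (0 : R) < n%:R by rewrite ltr0n.
rewrite (le_trans (bound n n0))//.
have := HN n (leq_maxl _ _); rewrite ger0_norm ?exprn_ge0 ?(ltW z0)// => h1.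
have h2 : z ^+ n / (1 - z) <= e / 2 by rewrite ler_pdivrMr.
have h3 : 2 * W / e <= n%:R.
  by rewrite ltW// (lt_le_trans (truncnS_gt _))// ler_nat leq_maxr.
have {}h3 : 2 * W <= n%:R * e by rewrite -ler_pdivrMr.
have h4 : n%:R^-1 * W <= e / 2.
  clearbody n; rewrite mulrC ler_pdivrMr//; lra.
by rewrite [leRHS]splitr lerD.
Qed.

(** From y / (1 + y) <= 1 - e^{-y} <= y the error lies between 0 and ln (1 + y), which is at most
    y. *)
Lemma exp_mean_harmonic_sum_range y : 0 < y ->
  0 <= exp_mean harmonic_sum y + ln y <= y.
Proof.
move=> y0; rewrite exp_mean_harmonic_sum//.
have ey1 : expR (- y) < 1 by rewrite expR_lt1 oppr_lt0.
have p : 0 < 1 - expR (- y) by rewrite subr_gt0.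
have h1 := expR_ge1Dx (- y); have h2 := expR_ge1Dx y.
have y1 : 0 < 1 + y by rewrite ltr_wpDl.
apply/andP; split.
  rewrite addrC subr_ge0 ler_ln ?posrE//; lra.
have : ln y <= ln ((1 - expR (- y)) * (1 + y)).
  rewrite ler_ln ?posrE ?mulr_gt0//.
  have : expR (- y) * (1 + y) <= 1.
    by rewrite expRN mulrC ler_pdivrMr ?expR_gt0// mul1r.
  by lra.
have ym : -1 < y by rewrite (lt_trans _ y0)// ltrN10.
by rewrite lnM ?posrE//; have := le_ln1Dx ym; lra.
Qed.

End Harmonic.

(** * Abelian lemma, polynomial weights and localization to a window *)

Section Tauberian.
Context {R : realType}.
Implicit Types (f h : R -> R) (x y t a b c m K X e : R) (p : {poly R}).

(** Beyond X the values are at most e / 2; on [0, X[ they are at most M = K e^X, and this window has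
    mass at most y X. *)
Lemma exp_mean_abel f : subexp f -> f x @[x --> +oo] --> (0 : R) ->
  exp_mean f y @[y --> 0^'+] --> (0 : R).
Proof.
move=> sf /cvgy0P f0; apply/cvg0rP => e e0.
have [X0 Xf0] := f0 (e / 2) ltac:(by rewrite divr_gt0).
pose X := Num.max 0 X0.
have X_ge0 : 0 <= X by rewrite /X le_max lexx.
have Xf x : X <= x -> `|f x| <= e / 2.
  by rewrite ge_max => /andP[_]; exact: Xf0.
have [K fK] := sf.2 1 ltr01.
have K0 : 0 <= K.
  by have := fK 0 (lexx 0); rewrite mulr0 expR0 mulr1; exact: le_trans.
pose M := K * expR X.
have M0 : 0 <= M by rewrite mulr_ge0 ?expR_ge0.
have MX : 0 < 2 * (M * X + 1) by rewrite mulr_gt0// ltr_wpDl// mulr_ge0.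
exists (e / (2 * (M * X + 1))) => [|y y0]; first by rewrite divr_gt0.
rewrite ler_pdivlMr// => yd.
have sw : subexp (fun t => (step 0 t - step X t) * M).
  by apply: subexp_window => //; exact: locbd_cst.
have : `|exp_mean f y| <= exp_mean (fun t => e / 2 + (step 0 t - step X t) * M) y.
  apply: norm_exp_mean => //; first by apply: subexpD => //; exact: subexp_cst.
  move=> t t0; rewrite /step t0; case: (boolP (X <= t)) => Xt.
    by rewrite subrr mul0r addr0 Xf.
  rewrite subr0 mul1r (le_trans (fK t t0))// -[leLHS]add0r lerD//.
    by rewrite divr_ge0 ?(ltW e0).
  by rewrite ler_wpM2l// ler_expR mul1r ltW// ltNge.
rewrite exp_meanD//; last exact: subexp_cst.
rewrite exp_mean_cst// exp_mean_window// => /le_trans; apply.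
have := ler_wpM2l M0 (expR_window_le y0 (lexx 0) X_ge0).
rewrite subr0 => hM.
have : 0 <= y * 1 by rewrite mulr1 ltW.
by nra.
Qed.

(** A weight e^{-kyt} only rescales y to (k + 1) y, so the limit at 0 controls every polynomial
    weight. *)
Lemma exp_meanX f y k : 0 < y -> subexp f ->
  exp_mean (fun t => expR (- (y * t)) ^+ k * f t) y =
  k.+1%:R^-1 * exp_mean f (k.+1%:R * y).
Proof.
move=> y0 sf; rewrite /exp_mean.
have ky0 : 0 < k.+1%:R * y by rewrite mulr_gt0.
rewrite -RintegralZl//; last exact: integrable_subexp.
apply: eq_Rintegral => t _.
have -> : - (k.+1%:R * y * t) = - (y * t) * k.+1%:R by ring.
rewrite expRM_natr exprS !mulrA mulVf ?mul1r// pnatr_eq0.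
Qed.

Lemma subexp_expRM f y : 0 < y -> subexp f ->
  subexp (fun t => expR (- (y * t)) * f t).
Proof.
move=> y0; apply: (@subexpM_bounded _ _ _ 1); first exact: measurable_expRM.
move=> t t0; rewrite ger0_norm ?expR_ge0// expR_le1 oppr_le0.
by rewrite mulr_ge0// ltW.
Qed.

Lemma subexp_horner p f y : 0 < y -> subexp f ->
  subexp (fun t => p.[expR (- (y * t))] * f t).
Proof.
move=> y0; elim/poly_ind: p f => [|p c IH] f sf.
  rewrite (_ : (fun _ => _) = (fun=> 0)); first exact: subexp_cst.
  by apply/funext => t; rewrite horner0 mul0r.
rewrite (_ : (fun _ => _) =
    (fun t => p.[expR (- (y * t))] * (expR (- (y * t)) * f t) + c * f t)).
  by apply: subexpD; [apply: IH; exact: subexp_expRM|exact: subexpZ].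
by apply/funext => t; rewrite hornerMXaddC; ring.
Qed.

Lemma subexp_expRX f y k : 0 < y -> subexp f ->
  subexp (fun t => expR (- (y * t)) ^+ k * f t).
Proof.
move=> y0 sf; have := subexp_horner 'X^k y0 sf.
by congr subexp; apply/funext => t; rewrite hornerXn.
Qed.

Lemma exp_mean_horner_cvg p f : subexp f ->
  exp_mean f y @[y --> 0^'+] --> (0 : R) ->
  exp_mean (fun t => p.[expR (- (y * t))] * f t) y @[y --> 0^'+] --> (0 : R).
Proof.
(* The extra power k makes the induction close: passing from p to p X + c raises it by one and
   leaves a pure power for c. *)
move=> sf /cvg0rP f0; suff H : forall k, 
   exp_mean (fun t => expR (- (y * t)) ^+ k * (p.[expR (- (y * t))] * f t)) y
     @[y --> 0^'+] --> (0 : R).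
  have /cvg0rP h := H 0%N; apply/cvg0rP => e e0; have [d d0 hd] := h e e0.
  exists d => // y y0 yd; have := hd y y0 yd; congr (`|_| <= _).
  by apply: eq_exp_mean => t _; rewrite expr0 mul1r.
elim/poly_ind: p => [|p c IH] k; apply/cvg0rP => e e0.
  exists 1 => // y y0 _; rewrite (@eq_exp_mean _ _ (fun=> 0)).
    by rewrite exp_mean_cst// normr0 ltW.
  by move=> t _; rewrite horner0 mul0r mulr0.
have e2 : 0 < e / 2 by rewrite divr_gt0.
have /cvg0rP/(_ _ e2)[d d0 hd] := IH k.+1.
have c0 : 0 < `|c| + 1 by rewrite ltr_wpDl.
have [d' d'0 hd'] := f0 (e / 2 / (`|c| + 1)) ltac:(by rewrite divr_gt0).
have k0 : (0 : R) < k.+1%:R by rewrite ltr0n.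
exists (Num.min d (d' / k.+1%:R)) => [|y y0].
  by rewrite lt_min d0 divr_gt0.
rewrite le_min => /andP[yd]; rewrite ler_pdivlMr// mulrC => yd'.
rewrite (@eq_exp_mean _ _ (fun t => expR (- (y * t)) ^+ k.+1 * (p.[expR (- (y * t))] * f t)
  + c * (expR (- (y * t)) ^+ k * f t))); last first.
  by move=> t _; rewrite hornerMXaddC exprS; ring.
have s1 : subexp (fun t => expR (- (y * t)) ^+ k.+1 * (p.[expR (- (y * t))] * f t)).
  by apply: subexp_expRX => //; exact: subexp_horner.
have s2 : subexp (fun t => expR (- (y * t)) ^+ k * f t) by exact: subexp_expRX.
rewrite exp_meanD//; last exact: subexpZ.
rewrite (exp_meanZ c y0 s2) (exp_meanX k y0 sf).
apply: (le_trans (ler_normD _ _)).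
have ky0 : 0 < k.+1%:R * y by rewrite mulr_gt0.
have := hd y y0 yd; have := hd' _ ky0 yd'; rewrite ler_pdivlMr// => h1 h2.
have h3 : `|c * (k.+1%:R^-1 * exp_mean f (k.+1%:R * y))| <= e / 2.
  rewrite (le_trans _ h1)// normrM mulrC ler_pM//; last by rewrite lerDl.
  rewrite normrM -[leRHS]mul1r ler_wpM2r//.
  by rewrite ger0_norm ?invr_ge0// invf_le1// ler1n.
by lra.
Qed.

Lemma bernoulli_ineq c (n : nat) : 0 <= c -> n%:R * c <= (1 + c) ^+ n.
Proof.
move=> c0; elim: n => [|n IH]; first by rewrite mul0r expr0.
have h : 1 <= (1 + c) ^+ n by rewrite exprn_ege1// lerDl.
rewrite exprS -natr1; nra.
Qed.

(* Landau kernels [(1 + r^2 - (z - v0)^2)^n] in [z = expR (- t / X)] blow up on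
   the part of [aX, bX] where |z - v0| <= r/2, and are at most 1 outside. *)
Lemma exp_mean_cvg0_window f K a b e : subexp f ->
  (forall t, 0 <= t -> `|f t| <= K) ->
  exp_mean f y @[y --> 0^'+] --> (0 : R) -> 0 < a -> a < b -> 0 < e ->
  exists2 X0, 0 < X0 & forall X m, X0 <= X ->
    (forall t, a * X <= t -> t <= b * X -> m <= f t) -> m <= e.
Proof.
move=> sf fK f0 a0 ab e0.
pose v1 := expR (- b); pose v2 := expR (- a).
have v12 : v1 < v2 by rewrite ltr_expR ltrN2.
have v1_gt0 : 0 < v1 by exact: expR_gt0.
have v2_lt1 : v2 < 1 by rewrite expR_lt1 oppr_lt0.
(* Centre and half-width of the image of the window under z = e^{-t/X}. *)
pose v0 := (v1 + v2) / 2; pose r := (v2 - v1) / 2.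
have r0 : 0 < r by rewrite /r; lra.
pose w1 := v0 - r / 2; pose w2 := v0 + r / 2.
have w1_gt0 : 0 < w1 by rewrite /w1 /v0 /r; lra.
have w12 : w1 < w2 by rewrite /w1 /w2; lra.
have w2_lt1 : w2 < 1 by rewrite /w2 /v0 /r; lra.
pose phi : {poly R} := (1 + r ^+ 2)%:P - ('X - v0%:P) ^+ 2.
have phiE z : phi.[z] = 1 + r ^+ 2 - (z - v0) ^+ 2 by rewrite /phi !hornerE.
(* On the inner half the kernel base is at least 1 + 3 r^2 / 4, and that half has mass w2 - w1 = r;
   by Bernoulli the kernel has mean at least n q. *)
pose q := 3 / 4 * r ^+ 2 * r.
have r2 : 0 < r ^+ 2 by rewrite exprn_gt0.
have q0 : 0 < q by rewrite mulr_gt0// mulr_gt0// divr_gt0.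
have K0 : 0 <= K by rewrite (le_trans (normr_ge0 _) (fK 0 (lexx 0))).
have qe : 0 < q * e by rewrite mulr_gt0.
(* If m > e, the weighted mean would be at least n q e - 2 K > 1, against the smallness obtained
   next. *)
pose n := (Num.truncn ((1 + 2 * K) / (q * e))).+1.
have nq : 1 + 2 * K < n%:R * (q * e) by rewrite -ltr_pdivrMr// truncnS_gt.
have /cvg0rP/(_ 1 ltr01)[d d0 hd] := exp_mean_horner_cvg (phi ^+ n) sf f0.
exists d^-1 => [|X m dX mf]; first by rewrite invr_gt0.
have X0 : 0 < X by apply: lt_le_trans dX; rewrite invr_gt0.
rewrite leNgt; apply/negP => em.
have mK : m <= K.
  have aX0 : 0 <= a * X by rewrite mulr_ge0 ?ltW.
  rewrite (le_trans (mf (a * X) (lexx _) _)) ?ler_pM2r ?(ltW ab)//.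
  by rewrite (le_trans (ler_norm _))// fK.
pose y := X^-1; have y0 : 0 < y by rewrite invr_gt0.
have yd : y <= d by rewrite -[d]invrK lef_pV2 ?posrE ?invr_gt0.
have {hd} := hd y y0 yd; rewrite ler_norml => /andP[_ hT].
pose z t := expR (- (y * t)).
have z01 t : 0 <= t -> 0 < z t <= 1.
  by move=> t0; rewrite expR_gt0 expR_le1 oppr_le0 mulr_ge0// ltW.
have phi0 t : 0 <= t -> 0 <= phi.[z t].
  move=> /z01/andP[z0 z1]; rewrite phiE.
  have h1 : -1 <= z t - v0 by rewrite /v0; lra.
  have h2 : z t - v0 <= 1 by rewrite /v0; lra.
  have := sqr_ge0 r; nra.
have s1 : subexp (fun t => (phi ^+ n).[z t]).
  have := subexp_horner (phi ^+ n) y0 (subexp_cst 1).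
  by congr subexp; apply/funext => t; rewrite mulr1.
have zin t : 0 <= t -> phi.[z t] <= 1 \/ m <= f t.
  move=> t0; case: (leP (phi.[z t]) 1) => [|]; [by left|rewrite phiE => h; right].
  have h1 : - r < z t - v0 by rewrite ltNge; apply/negP => h1; nra.
  have h2 : z t - v0 < r by rewrite ltNge; apply/negP => h2; nra.
  have vz : v1 < z t by move: h1; rewrite /v0 /r; lra.
  have zv : z t < v2 by move: h2; rewrite /v0 /r; lra.
  move: vz zv; rewrite /z /v1 /v2 !ltr_expR !ltrN2 /y mulrC.
  rewrite ltr_pdivrMr// ltr_pdivlMr// => /ltW h3 /ltW h4.
  exact: mf.
(* Where f may be below m the kernel is at most 1, and there m - f <= 2 K. *)
have T1 : m * exp_mean (fun t => (phi ^+ n).[z t]) y - 2 * K <= 1.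
  apply: le_trans hT.
  rewrite -exp_meanZ// -[X in _ - X](@exp_mean_cst _ _ y)// -exp_meanB//; last first.
  - exact: subexp_cst.
  - exact: subexpZ.
  apply: le_exp_mean => //.
  - by apply: subexpB; [exact: subexpZ|exact: subexp_cst].
  - exact: subexp_horner.
  move=> t t0; have p0 : 0 <= (phi ^+ n).[z t] by rewrite horner_exp exprn_ge0// phi0.
  rewrite -/(z t); case: (zin t t0) => [p1|mft]; last first.
    have := ler_wpM2l p0 mft; lra.
  have p1' : (phi ^+ n).[z t] <= 1 by rewrite horner_exp exprn_ile1// phi0.
  have := fK t t0; rewrite ler_norml => /andP[hf _].
  set P := (phi ^+ n).[z t] in p0 p1' *.
  have : 0 <= P * (f t + K) by rewrite mulr_ge0//; lra.
  have : 0 <= (1 - P) * (2 * K) by rewrite mulr_ge0 ?subr_ge0// mulr_ge0.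
  have : 0 <= P * (K - m) by rewrite mulr_ge0// subr_ge0.
  by lra.
(* The times at which z equals w2 and w1; z decreases, so the order is reversed. *)
pose u := - ln w2 * X; pose v := - ln w1 * X.
have w2_gt0 : 0 < w2 by exact: lt_trans w12.
have u0 : 0 <= u by rewrite mulr_ge0 ?(ltW X0)// oppr_ge0 ln_le0// ltW.
have uv : u <= v by rewrite ler_pM2r// lerN2 ler_ln ?posrE// ltW.
have zu : expR (- (y * u)) = w2.
  by rewrite /u /y mulrC mulfK ?gt_eqF// opprK lnK ?posrE.
have zv : expR (- (y * v)) = w1.
  by rewrite /v /y mulrC mulfK ?gt_eqF// opprK lnK ?posrE.
have T2 : n%:R * q <= exp_mean (fun t => (phi ^+ n).[z t]) y.
  have -> : n%:R * q = n%:R * (3 / 4 * r ^+ 2) * (expR (- (y * u)) - expR (- (y * v))).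
    by rewrite zu zv /q /w1 /w2; field.
  rewrite -exp_mean_window//; apply: le_exp_mean => //.
    by apply: subexp_window => //; exact: locbd_cst.
  move=> t t0; have p0 : 0 <= (phi ^+ n).[z t] by rewrite horner_exp exprn_ge0// phi0.
  rewrite /step; case: (boolP (v <= t)) => vt.
    by rewrite (le_trans uv vt) subrr mul0r.
  case: (boolP (u <= t)) => ut; last by rewrite subrr mul0r.
  rewrite subr0 mul1r horner_exp.
  have c0 : 0 <= 3 / 4 * r ^+ 2 by rewrite mulr_ge0// sqr_ge0.
  apply: le_trans (bernoulli_ineq n c0) _.
  rewrite lerXn2r ?nnegrE ?addr_ge0 ?phi0// phiE.
  have h1 : z t <= w2 by rewrite -zu ler_expR lerN2 ler_pM2l.
  have h2 : w1 <= z t by rewrite -zv ler_expR lerN2 ler_pM2l// ltW// ltNge.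
  have h3 : z t - v0 <= r / 2 by move: h1; rewrite /w2; lra.
  have h4 : - (r / 2) <= z t - v0 by move: h2; rewrite /w1; lra.
  nra.
have m0 : 0 < m by exact: lt_trans em.
have := ler_wpM2l (ltW m0) T2.
have : e * (n%:R * q) <= m * (n%:R * q).
  by rewrite ler_wpM2r ?(ltW em)// mulr_ge0// ltW.
by lra.
Qed.

End Tauberian.

(** * Tauberian theorem for a nondecreasing function against the harmonic sum *)

Section HarmonicTauberian.
Context {R : realType}.
Implicit Types (f h s : R -> R) (x y t a b c e : R).

(* Both bounds integrate the sign of a combination of [expR (- (y * t))] and
   [expR (- (2 * y * t))] that vanishes at [t = x], where [h t - h x] changes
   sign too. *)
Lemma nondecreasing_exp_mean_bounds h x y : (forall t u, t <= u -> h t <= h u) ->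
  subexp h -> 0 < y -> 0 < x ->
  (expR (- (y * x)) = 3 / 4 -> h x <= 3 * exp_mean h y - 2 * exp_mean h (2 * y)) /\
  (expR (- (y * x)) = 1 / 4 -> 2 * exp_mean h (2 * y) - exp_mean h y <= h x).
Proof.
move=> ndh sh y0 x0.
have sg (p q : R) : subexp (fun t => p + q * expR (- (y * t))).
  apply: subexpD; first exact: subexp_cst.
  apply: subexpZ; have := subexp_expRM y0 (subexp_cst (1 : R)).
  by congr subexp; apply/funext => t; rewrite mulr1.
have E (p q : R) : exp_mean (fun t => (p + q * expR (- (y * t))) * (h t - h x)) y =
  p * exp_mean h y + q / 2 * exp_mean h (2 * y) - (p + q / 2) * h x.
  have e1 : exp_mean (fun t => expR (- (y * t)) ^+ 1 * h t) y =
    2^-1 * exp_mean h (2 * y) by rewrite exp_meanX.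
  have e2 : exp_mean (fun t => expR (- (y * t)) ^+ 1 * 1) y = 2^-1.
    by rewrite exp_meanX ?exp_mean_cst ?mulr_gt0 ?mulr1//; exact: subexp_cst.
  have s1 := subexp_expRX 1 y0 sh; have s2 := subexp_expRX 1 y0 (subexp_cst (1 : R)).
  rewrite (@eq_exp_mean _ _ (fun t => (p * h t + q * (expR (- (y * t)) ^+ 1 * h t)) -
     (p * h x + (q * h x) * (expR (- (y * t)) ^+ 1 * 1)))); last first.
    by move=> t _; rewrite expr1; ring.
  rewrite exp_meanB//; first last.
  - by apply: subexpD; [exact: subexp_cst|exact: subexpZ].
  - by apply: subexpD; exact: subexpZ.
  rewrite exp_meanD//; [|exact: subexpZ|exact: subexpZ].
  rewrite exp_meanD//; [|exact: subexp_cst|exact: subexpZ].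
  rewrite !exp_meanZ ?e1 ?e2 ?exp_mean_cst//; last exact: subexp_cst.
  by field.
have ge0 (p q : R) :
    (forall t, 0 <= t -> 0 <= (p + q * expR (- (y * t))) * (h t - h x)) ->
    0 <= p * exp_mean h y + q / 2 * exp_mean h (2 * y) - (p + q / 2) * h x.
  move=> pq; rewrite -E -[leLHS](@exp_mean_cst R 0 y y0).
  apply: le_exp_mean => //; first exact: subexp_cst.
  by apply: (subexpM (sg p q)); apply: subexpB => //; exact: subexp_cst.
split=> yx.
  (* The weight 3 - 4 z vanishes at z = 3/4 and has mean 3 - 4/2 = 1, the coefficient of h(x). *)
  suff : 0 <= 3 * exp_mean h y + - 4 / 2 * exp_mean h (2 * y) - (3 + - 4 / 2) * h x.
    by clear; lra.
  apply: ge0 => t t0; have [tx|xt] := leP t x.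
    apply: mulr_le0; last by rewrite subr_le0 ndh.
    have : expR (- (y * x)) <= expR (- (y * t)) by rewrite ler_expR lerN2 ler_pM2l.
    by rewrite yx => H'; clear -H'; lra.
  apply: mulr_ge0; last by rewrite subr_ge0 ndh// ltW.
  have : expR (- (y * t)) <= expR (- (y * x)) by rewrite ler_expR lerN2 ler_pM2l// ltW.
  by rewrite yx => H'; clear -H'; lra.
(* The weight 1 - 4 z vanishes at z = 1/4 and has mean -1, which reverses the bound. *)
suff : 0 <= 1 * exp_mean h y + - 4 / 2 * exp_mean h (2 * y) - (1 + - 4 / 2) * h x.
  by clear; lra.
apply: ge0 => t t0; have [tx|xt] := leP t x.
  apply: mulr_le0; last by rewrite subr_le0 ndh.
  have : expR (- (y * x)) <= expR (- (y * t)) by rewrite ler_expR lerN2 ler_pM2l.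
  by rewrite yx => H'; clear -H'; lra.
apply: mulr_ge0; last by rewrite subr_ge0 ndh// ltW.
have : expR (- (y * t)) <= expR (- (y * x)) by rewrite ler_expR lerN2 ler_pM2l// ltW.
by rewrite yx => H'; clear -H'; lra.
Qed.

(** Take y = l / x with l = ln (4/3) or ln 4, so that e^{-yx} is 3/4 or 1/4. Both combinations of
    means have coefficients summing to 1, so b ln x survives exactly and only constants remain. *)
Lemma nondecreasing_log_bounded h b c1 c2 d : (forall t u, t <= u -> h t <= h u) ->
  subexp h -> 0 < d ->
  (forall y, 0 < y -> y <= d ->
    c1 - b * ln y <= exp_mean h y /\ exp_mean h y <= c2 - b * ln y) ->
  exists X K, [/\ 1 <= X & forall x, X <= x -> `|h x - b * ln x| <= K].
Proof.
move=> ndh sh d0 mh.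
have half l x : 0 < l -> 2 * l / d <= x -> 0 < x ->
    0 < l / x /\ 2 * (l / x) <= d.
  move=> l0 dx x0; split; first exact: divr_gt0.
  by rewrite mulrA ler_pdivrMr// (mulrC d) -ler_pdivrMr.
have mh2 l x : 0 < l -> 2 * l / d <= x -> 0 < x ->
  [/\ c1 - b * (ln l - ln x) <= exp_mean h (l / x),
      exp_mean h (l / x) <= c2 - b * (ln l - ln x),
      c1 - b * (ln 2 + (ln l - ln x)) <= exp_mean h (2 * (l / x)) &
      exp_mean h (2 * (l / x)) <= c2 - b * (ln 2 + (ln l - ln x))].
  move=> l0 dx x0; have [lx lxd] := half l x l0 dx x0.
  have lxd' : l / x <= d by rewrite (le_trans _ lxd)// ler_peMl ?ler1n ?ltW.
  have [m1 m2] := mh _ lx lxd'.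
  have lx2 : 0 < 2 * (l / x) by rewrite mulr_gt0.
  have [m3 m4] := mh _ lx2 lxd.
  have lnE1 : ln (l / x) = ln l - ln x by rewrite ln_div.
  have lnE2 : ln (2 * (l / x)) = ln 2 + (ln l - ln x) by rewrite lnM ?posrE// lnE1.
  by rewrite -lnE2 -lnE1; split; [exact: m1|exact: m2|exact: m3|exact: m4].
have la0 : 0 < ln (4 / 3) :> R by rewrite ln_gt0// ltr_pdivlMr// mul1r ltr_nat.
have lb0 : 0 < ln 4 :> R by rewrite ln_gt0// ltr1n.
have ela : expR (- ln (4 / 3)) = 3 / 4 :> R.
  by rewrite expRN lnK ?posrE ?divr_gt0// invf_div.
have elb : expR (- ln 4) = 1 / 4 :> R by rewrite expRN lnK ?posrE// div1r.
move: la0 lb0 ela elb; set la : R := ln (4 / 3); set lb : R := ln 4.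
move: la lb => la lb la0 lb0 ela elb.
exists (Num.max 1 (Num.max (2 * la / d) (2 * lb / d))).
pose U := 3 * c2 - 2 * c1 + 2 * b * ln 2 - b * ln la.
pose L := 2 * c1 - c2 - 2 * b * ln 2 - b * ln lb.
exists (`|U| + `|L|); split; first by rewrite le_max lexx.
move=> x; rewrite !ge_max => /and3P[x1 dxa dxb].
have x0 : 0 < x by exact: lt_le_trans x1.
have [ax _] := half la x la0 dxa x0; have [bx _] := half lb x lb0 dxb x0.
have [_ a2 a3 _] := mh2 la x la0 dxa x0; have [_ b2 b3 _] := mh2 lb x lb0 dxb x0.
have [hu _] := nondecreasing_exp_mean_bounds ndh sh ax x0.
have [_ hl] := nondecreasing_exp_mean_bounds ndh sh bx x0.
rewrite divfK ?gt_eqF// in hu; rewrite divfK ?gt_eqF// in hl.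
have {}hu := hu ela; have {}hl := hl elb.
have hU : h x - b * ln x <= U by rewrite /U; clear -hu a2 a3; lra.
have hL : L <= h x - b * ln x by rewrite /L; clear -hl b2 b3; lra.
rewrite ler_norml; apply/andP; split.
  rewrite (le_trans _ hL)// opprD -[leRHS]add0r lerD ?oppr_le0//.
  by rewrite lerNl -normrN ler_norm.
by rewrite (le_trans hU)// -[leLHS]addr0 lerD ?ler_norm.
Qed.

(** The hypothesis is rewritten with ln y to bound h - b ln, then ln is traded back for the harmonic
    sum near infinity; local boundedness covers the rest. *)
Lemma tauberian_bounded h b c : (forall t u, t <= u -> h t <= h u) ->
  subexp h -> 0 <= b ->
  (exp_mean h y - b * exp_mean (@harmonic_sum R) y - c) @[y --> 0^'+] --> (0 : R) ->
  exists K, forall t, 0 <= t -> `|h t - b * harmonic_sum t - c| <= K.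
Proof.
move=> ndh sh b0 /cvg0rP/(_ 1 ltr01)[d0 d0_gt0 hd0].
have d_gt0 : 0 < Num.min d0 1 by rewrite lt_min d0_gt0 ltr01.
have mh y : 0 < y -> y <= Num.min d0 1 ->
   c - 1 - b * ln y <= exp_mean h y /\ exp_mean h y <= c + 1 + b - b * ln y.
  move=> y0; rewrite le_min => /andP[yd y1].
  have := hd0 y y0 yd; rewrite ler_norml => /andP[h1 h2].
  have /andP[h3 h4] := exp_mean_harmonic_sum_range y0.
  have h5 := ler_wpM2l b0 h3; have h6 := ler_wpM2l b0 (le_trans h4 y1).
  by clear -h1 h2 h5 h6; split; lra.
have /cvgy0P/(_ 1 ltr01)[X1 hX1] := @harmonic_sum_cvg R.
have [X2 [K2 [_ hX2]]] := nondecreasing_log_bounded ndh sh d_gt0 mh.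
pose X := Num.max X1 X2.
pose g := @euler_gamma R.
have big x : X <= x -> `|h x - b * harmonic_sum x - c| <= K2 + b + `|b * g + c|.
  rewrite ge_max => /andP[X1x X2x].
  have -> : h x - b * harmonic_sum x - c =
    (h x - b * ln x) - b * (harmonic_sum x - ln x - g) - (b * g + c) by ring.
  rewrite (le_trans (ler_normB _ _))// lerD2r (le_trans (ler_normB _ _))//.
  rewrite lerD ?hX2// normrM (ger0_norm b0) -[leRHS]mulr1.
  by rewrite ler_wpM2l// hX1.
have bt : locbd (fun t => h t - b * harmonic_sum t - c).
  apply: locbdB; last exact: locbd_cst.
  apply: locbdB; first by apply: nondecreasing_locbd => u v _; exact: ndh.
  apply: locbdZ; apply: nondecreasing_locbd => u v _.
  exact: harmonic_sum_nondecreasing.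
have [L hL] := bt.2 X; exists (Num.max (K2 + b + `|b * g + c|) L) => t t0.
have [tX|Xt] := leP t X; first by rewrite le_max hL ?orbT// t0.
by rewrite le_max big// ltW.
Qed.

(** Euler's constant cancels in the difference. Used to limit the fall of h - b H across a window of
    ratio r. *)
Lemma harmonic_sum_scale (r e : R) : 1 <= r -> 0 < e -> exists2 X, 0 < X &
  forall x, X <= x -> harmonic_sum (r * x) - harmonic_sum x <= ln r + e.
Proof.
move=> r1 e0; have /cvgy0P/(_ (e / 2) ltac:(by rewrite divr_gt0))[X hX] := @harmonic_sum_cvg R.
exists (Num.max 1 X) => [|x]; first by rewrite lt_max ltr01.
rewrite ge_max => /andP[x1 Xx].
have x0 : 0 < x by exact: lt_le_trans x1.
have r0 : 0 < r by exact: lt_le_trans r1.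
have xrx : x <= r * x by rewrite ler_peMl// ltW.
have := hX x Xx; have := hX _ (le_trans Xx xrx).
rewrite lnM ?posrE// !ler_norml => /andP[_ h1] /andP[h2 _]; lra.
Qed.

(** With tau = h - b H - c, the upper bound on tau(x) uses the window to the right of x, where tau
    >= tau(x) - e/2; the lower bound uses the window ending at x, where tau <= tau(x) + e/2. *)
Lemma harmonic_tauberian h b c : (forall t u, t <= u -> h t <= h u) ->
  subexp h -> 0 <= b ->
  (exp_mean h y - b * exp_mean (@harmonic_sum R) y - c) @[y --> 0^'+] --> (0 : R) ->
  (h x - b * harmonic_sum x - c) @[x --> +oo] --> (0 : R).
Proof.
move=> ndh sh b0 hm.
have [K tK] := tauberian_bounded ndh sh b0 hm.
pose tau t := h t - b * harmonic_sum t - c.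
have sbH : subexp (fun t => b * @harmonic_sum R t) by apply: subexpZ; exact: subexp_harmonic_sum.
have st : subexp tau.
  by apply: subexpB; [exact: subexpB|exact: subexp_cst].
have mt : exp_mean tau y @[y --> 0^'+] --> (0 : R).
  apply/cvg0rP => e e0; have /cvg0rP/(_ e e0)[d d0 hd] := hm.
  exists d => // y y0 yd; have := hd y y0 yd; congr (`|_| <= _).
  rewrite exp_meanB//; last exact: subexp_cst; last exact: subexpB.
  rewrite exp_meanB// exp_meanZ// ?exp_mean_cst//; exact: subexp_harmonic_sum.
have mtN : exp_mean (fun t => -1 * tau t) y @[y --> 0^'+] --> (0 : R).
  apply/cvg0rP => e e0; have /cvg0rP/(_ e e0)[d d0 hd] := mt.
  by exists d => // y y0 yd; rewrite exp_meanZ// normrM normrN1 mul1r hd.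
apply/cvgy0P => e e0.
have b1 : 0 < b + 1 by rewrite ltr_wpDl.
(* Makes 2 b w <= e / 2: one w bounds ln (1 + w), the other is the error allowed in
   [harmonic_sum_scale]. *)
pose w := e / (4 * (b + 1)).
have w0 : 0 < w by rewrite divr_gt0// mulr_gt0.
have r1 : 1 < 1 + w by rewrite ltrDl.
have [X hX_gt0 hX] := harmonic_sum_scale (ltW r1) w0.
have lnw : ln (1 + w) <= w by apply: le_ln1Dx; rewrite (lt_trans _ w0)// ltrN10.
have bw : b * (2 * w) <= e / 2.
  have -> : b * (2 * w) = e / 2 * (b / (b + 1)) by rewrite /w; field; rewrite gt_eqF.
  by rewrite ler_piMr ?divr_ge0 ?(ltW e0)// ler_pdivrMr// mul1r lerDl.
have inc x : X <= x -> b * (harmonic_sum ((1 + w) * x) - harmonic_sum x) <= e / 2.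
  move=> Xx; apply: le_trans bw; rewrite ler_wpM2l// (le_trans (hX x Xx))//.
  by lra.
have e2 : 0 < e / 2 by rewrite divr_gt0.
have tKN t : 0 <= t -> `|-1 * tau t| <= K by move=> t0; rewrite normrM normrN1 mul1r tK.
have [Y1 Y1_gt0 hY1] := exp_mean_cvg0_window st tK mt ltr01 r1 e2.
have [Y2 Y2_gt0 hY2] := exp_mean_cvg0_window (subexpZ (-1) st) tKN mtN ltr01 r1 e2.
pose Z := Num.max X (Num.max Y1 Y2).
have r0 : 0 < 1 + w by exact: lt_trans r1.
(* The factor 1 + w keeps the left window's start x / (1 + w) beyond Z as well. *)
exists ((1 + w) * Z) => x Zx.
have Z0 : 0 < Z by rewrite lt_max hX_gt0.
have ZZ : Z <= (1 + w) * Z by rewrite ler_peMl// ltW.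
have /and3P[Xx Y1x _] : [&& X <= x, Y1 <= x & Y2 <= x].
  by have := le_trans ZZ Zx; rewrite !ge_max.
pose x' := x / (1 + w).
have xE : (1 + w) * x' = x by rewrite /x' mulrC divfK// gt_eqF.
have /and3P[Xx' _ Y2x'] : [&& X <= x', Y1 <= x' & Y2 <= x'].
  have : Z <= x' by rewrite ler_pdivlMr// mulrC.
  by rewrite !ge_max.
rewrite ler_norml; apply/andP; split.
  have : -1 * tau x - e / 2 <= e / 2.
    apply: (hY2 x' _ Y2x') => t; rewrite mul1r xE => xt tx.
    have h1 := ndh _ _ tx.
    have h2 := ler_wpM2l b0 (harmonic_sum_nondecreasing xt).
    have := inc x' Xx'; rewrite xE => h3.
    by rewrite /tau; lra.
  by rewrite /tau; lra.
have : tau x - e / 2 <= e / 2.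
  apply: (hY1 x _ Y1x) => t; rewrite mul1r => xt tx.
  have h1 := ndh _ _ xt.
  have h2 := ler_wpM2l b0 (harmonic_sum_nondecreasing tx).
  have h3 := inc x Xx.
  by rewrite /tau; lra.
by rewrite /tau; lra.
Qed.

End HarmonicTauberian.

(** * The two implications for the Laplace transform *)

Section LaplaceTauberian.
Context {R : realType}.
Implicit Types (f g s : R -> R) (x y t a b c e : R).

Lemma eq_cvgy0 f g X : (forall x, X <= x -> f x = g x) ->
  f x @[x --> +oo] --> (0 : R) -> g x @[x --> +oo] --> (0 : R).
Proof.
move=> fg /cvgy0P f0; apply/cvgy0P => e e0; have [Y fY] := f0 e e0.
exists (Num.max X Y) => x; rewrite ge_max => /andP[Xx Yx].
by rewrite -fg// fY.
Qed.

Lemma eq_cvg0r f g : (forall y, 0 < y -> f y = g y) ->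
  f y @[y --> 0^'+] --> (0 : R) -> g y @[y --> 0^'+] --> (0 : R).
Proof.
move=> fg /cvg0rP f0; apply/cvg0rP => e e0; have [d d0 fd] := f0 e e0.
by exists d => // y y0 yd; rewrite -fg// fd.
Qed.

Lemma cvg0Ml (F : set_system R) {FF : Filter F} f c :
  f x @[x --> F] --> (0 : R) -> (c * f x) @[x --> F] --> (0 : R).
Proof. by move=> f0; rewrite -(mulr0 c); apply: cvgM => //; exact: cvg_cst. Qed.

Lemma cvg0D (F : set_system R) {FF : Filter F} f g :
  f x @[x --> F] --> (0 : R) -> g x @[x --> F] --> (0 : R) ->
  (f x + g x) @[x --> F] --> (0 : R).
Proof. by move=> f0 g0; rewrite -(addr0 0); apply: cvgD. Qed.

Lemma exp_mean_harmonic_sum_cvg :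
  (exp_mean (@harmonic_sum R) y + ln y) @[y --> 0^'+] --> (0 : R).
Proof.
apply/cvg0rP => e e0; exists e => // y y0 ye.
have /andP[h1 h2] := exp_mean_harmonic_sum_range y0.
by rewrite ger0_norm// (le_trans h2).
Qed.

(** Turns the logarithmic monotonicity condition into a linear one: s(x) + (A / B) x is
    nondecreasing beyond B. *)
Lemma ln_lipschitz (B u v : R) : 0 < B -> B <= u -> u <= v ->
  ln v - ln u <= B^-1 * (v - u).
Proof.
move=> B0 Bu uv; have u0 := lt_le_trans B0 Bu; have v0 := lt_le_trans u0 uv.
rewrite -ln_div ?posrE//.
have vu : 1 <= v / u by rewrite ler_pdivlMr// mul1r.
have e : v / u = 1 + (v - u) / u by field; rewrite gt_eqF.
have d0 : 0 <= (v - u) / u by rewrite divr_ge0 ?subr_ge0// ltW.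
rewrite e (le_trans (le_ln1Dx _))//; first by rewrite (lt_le_trans _ d0)// ltrN10.
by rewrite mulrC ler_wpM2r ?subr_ge0// lef_pV2 ?posrE.
Qed.

Lemma subexp_comp_max f (B : R) : 0 <= B ->
  measurable_fun (`[0, +oo[ : set R) (fun t => f (Num.max B t)) ->
  subexp f -> subexp (fun t => f (Num.max B t)).
Proof.
move=> B0 mf [_ fe]; split => // e e0; have [K fK] := fe e e0.
have K0 : 0 <= K.
  by have := fK 0 (lexx 0); rewrite mulr0 expR0 mulr1; exact: le_trans.
exists (K * expR (e * B)) => t t0.
rewrite (le_trans (fK _ _)) ?le_max ?B0// -mulrA ler_wpM2l// -expRD ler_expR.
by rewrite -mulrDr ler_wpM2l ?(ltW e0)// ge_max lerDl lerDr B0 t0.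
Qed.

Lemma subexp_ln_max1 : subexp (fun t : R => ln (Num.max 1 t)).
Proof.
have m1 t : 0 < Num.max 1 t :> R by rewrite lt_max ltr01.
split.
  apply: nondecreasing_measurable => // u v uv.
  by rewrite ler_ln ?posrE// ge_max !le_max lexx uv orbT.
move=> e e0; have [K tK] := (@subexp_id R).2 e e0; exists K => t t0.
rewrite (le_trans _ (tK t t0))// (ger0_norm t0) ger0_norm; last first.
  by rewrite ln_ge0// le_max lexx.
have [t1|t1] := leP t 1; first by rewrite ln1.
by rewrite ltW// ln_sublinear// (lt_trans _ t1).
Qed.

Lemma laplace_C_exp_meanE s : locally_bv s ->
  (forall y, 0 < y -> laplace_C_exists s y) ->
  (exists A B : R, [/\ 0 < A, 0 < B &
     forall x1 x2 : R, B <= x1 -> x1 <= x2 ->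
       s x1 + A * ln x1 <= s x2 + A * ln x2]) ->
  subexp s /\ forall y, 0 < y -> laplace_C s y = exp_mean s y - s 0.
Proof.
move=> bs exL [A [B [A0 B0 sA]]].
have [V sV] := locally_bv_variation bs.
have ss : subexp s.
  apply: (@subexp_laplace_C R s V B (A / B)) => //; [exact: ltW| |].
    by rewrite divr_ge0// ltW.
  move=> u v Bu uv; have := sA u v Bu uv.
  have := ler_wpM2l (ltW A0) (ln_lipschitz B0 Bu uv).
  by rewrite mulrA; lra.
by split => // y y0; rewrite (laplace_C_exp_mean y0 sV ss (exL y y0)).
Qed.

(** The term b gamma of s is absorbed by b H, whereas the mean of H is log (1/y) with no constant;
    hence gamma appears on one side only. *)
Lemma abelian_half s a b : subexp s ->
  (s x - (s 0 + a + b * euler_gamma + b * ln x)) @[x --> +oo] --> (0 : R) ->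
  (exp_mean s y - s 0 - (a + b * ln (y^-1))) @[y --> 0^'+] --> (0 : R).
Proof.
move=> ss sx.
pose f x := s x - (s 0 + a) - b * harmonic_sum x.
have sH := @subexp_harmonic_sum R.
have sf : subexp f.
  by apply: subexpB; [apply: subexpB => //; exact: subexp_cst|exact: subexpZ].
have f0 : f x @[x --> +oo] --> (0 : R).
  apply: (eq_cvgy0 (X := 0) _ (cvg0D sx (cvg0Ml (- b) (@harmonic_sum_cvg R)))).
  by move=> x _; rewrite /f; ring.
apply: (eq_cvg0r _ (cvg0D (exp_mean_abel sf f0)
  (cvg0Ml b exp_mean_harmonic_sum_cvg))) => y y0.
rewrite lnV ?posrE// /f exp_meanB//; last exact: subexpZ; last first.
  by apply: subexpB => //; exact: subexp_cst.
rewrite exp_meanB//; last exact: subexp_cst.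
by rewrite exp_meanZ// exp_mean_cst//; ring.
Qed.

Lemma tauberian_half s a b : subexp s ->
  (exists A B : R, [/\ 0 < A, 0 < B &
     forall x1 x2 : R, B <= x1 -> x1 <= x2 ->
       s x1 + A * ln x1 <= s x2 + A * ln x2]) ->
  (exp_mean s y - s 0 - (a + b * ln (y^-1))) @[y --> 0^'+] --> (0 : R) ->
  (s x - (s 0 + a + b * euler_gamma + b * ln x)) @[x --> +oo] --> (0 : R).
Proof.
move=> ss [A0 [B0 [A0_gt0 B0_gt0 sA]]] sy.
(* Enlarging the constant preserves monotonicity and makes A + b nonnegative, as
   [harmonic_tauberian] requires. *)
pose A := A0 + `|b|.
have [B [B1 B0B]] : exists B, 1 <= B /\ B0 <= B.
  by exists (Num.max 1 B0); rewrite !le_max !lexx orbT.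
have B_gt0 : 0 < B by exact: lt_le_trans B1.
have B_ge0 : 0 <= B by exact: ltW.
have sH := @subexp_harmonic_sum R.
(* The logarithm is frozen below 1 and h is constant below B, which makes h nondecreasing on the
   whole line without changing it beyond B. *)
pose g t := s t + A * ln (Num.max 1 t).
pose h t := g (Num.max B t).
have hE x : B <= x -> h x = s x + A * ln x.
  move=> Bx; rewrite /h /g (max_r Bx) max_r//; exact: le_trans Bx.
have ndh : forall t u, t <= u -> h t <= h u.
  move=> t u tu.
  suff H v w : B <= v -> v <= w -> h v <= h w.
    have -> : h t = h (Num.max B t) by rewrite /h maxA maxxx.
    have -> : h u = h (Num.max B u) by rewrite /h maxA maxxx.
    apply: H; first by rewrite le_max lexx.
    by rewrite ge_max !le_max lexx tu orbT.
  move=> Bv vw; rewrite !hE//; last exact: le_trans vw.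
  have v0 : 0 < v by exact: lt_le_trans Bv.
  have B0v : B0 <= v by exact: le_trans Bv.
  have := sA v w B0v vw.
  have : ln v <= ln w by rewrite ler_ln ?posrE// (lt_le_trans v0).
  move=> /(ler_wpM2l (normr_ge0 b)); rewrite /A; lra.
have sg : subexp g by apply: subexpD => //; apply: subexpZ; exact: subexp_ln_max1.
have sh : subexp h.
  apply: subexp_comp_max => //.
  by apply: nondecreasing_measurable.
(* Beyond B this is - A (H - ln - gamma), hence tends to 0; the Abelian lemma then carries the
   hypothesis from s to h. *)
pose r t := h t - s t - A * harmonic_sum t + A * euler_gamma.
have shs : subexp (fun t => h t - s t) by exact: subexpB.
have shA : subexp (fun t => h t - s t - A * harmonic_sum t).
  by apply: subexpB => //; exact: subexpZ.
have sr : subexp r by apply: subexpD => //; exact: subexp_cst.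
have r0 : r x @[x --> +oo] --> (0 : R).
  apply: (eq_cvgy0 (X := B) _ (cvg0Ml (- A) (@harmonic_sum_cvg R))) => x Bx.
  by rewrite /r hE//; ring.
have Ab : 0 <= A + b.
  by have := ler_norm (- b); rewrite normrN /A; lra.
have hx : (h x - (A + b) * harmonic_sum x - (a + s 0 - A * euler_gamma))
    @[x --> +oo] --> (0 : R).
  apply: harmonic_tauberian => //.
  apply: (eq_cvg0r _ (cvg0D (cvg0D (exp_mean_abel sr r0) sy)
    (cvg0Ml (- b) exp_mean_harmonic_sum_cvg))) => y y0.
  rewrite /r exp_meanD//; last exact: subexp_cst.
  rewrite exp_meanB//; last exact: subexpZ.
  by rewrite exp_meanB// exp_meanZ// exp_mean_cst// lnV ?posrE//; ring.
apply: (eq_cvgy0 (X := B) _ (cvg0D hx (cvg0Ml (A + b) (@harmonic_sum_cvg R)))).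
by move=> x Bx; rewrite hE//; ring.
Qed.

End LaplaceTauberian.

Theorem theorem3p7 (R : realType) (s : R -> R) (a b : R) :
  locally_bv s ->
  (forall x : R, x < 0 -> s x = 0) ->
  (forall y : R, 0 < y -> laplace_C_exists s y) ->
  (exists A B : R, [/\ 0 < A, 0 < B &
     forall x1 x2 : R, B <= x1 -> x1 <= x2 ->
       s x1 + A * ln x1 <= s x2 + A * ln x2]) ->
  ((fun y => laplace_C s y - (a + b * ln (y^-1))) y @[y --> 0^'+] --> 0)
  <->
  ((fun x => s x - (s 0 + a + b * euler_gamma + b * ln x)) x @[x --> +oo] --> 0).
Proof.
move=> bs _ exL sA.
have [ss lE] := laplace_C_exp_meanE bs exL sA.
split=> [H|/(abelian_half ss)].
  apply: (tauberian_half ss sA); apply: eq_cvg0r H => y y0.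
  by rewrite lE.
by apply: eq_cvg0r => y y0; rewrite lE.
Qed.
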